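(* For all complex numbers $z$ with $\Re(z)>-\frac12$ and $z\notin\{\frac12+k:k\in\mathbb{Z}\}$, $$\sum_{n=0}^\infty\frac{1}{4^n}\binom{2n}{n}\frac{z-2n}{\binom{z-1/2}{n}}\binom{z}{n}^3=\frac{\tan(\pi z)}{\pi}.$$ In particular, for all nonnegative integers $m$, $$\sum_{n=0}^\infty\frac{1}{4^{n+1}}\binom{2n}{n}\frac{4m+1-8n}{\binom{m-1/4}{n}}\binom{m+1/4}{n}^3=\frac{1}{\pi}.$$
   Context: For a complex number $w$ and a nonnegative integer $n$, $\binom{w}{n}=\frac{w(w-1)\cdots(w-n+1)}{n!}$ (with $\binom{w}{0}=1$). *)

(* Defs.v *)
From Stdlib Require Import Reals Factorial.
From Coquelicot Require Export Coquelicot.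

Open Scope C_scope.

Fixpoint Cfalling (w : C) (n : nat) : C :=
  match n with
  | O => 1
  | S k => Cfalling w k * (w - INR k)
  end.

Definition Cbinom (w : C) (n : nat) : C := Cfalling w n / INR (fact n).

Definition Cexp (z : C) : C :=
  RtoC (exp (Re z)) * (cos (Im z) + Ci * sin (Im z)).

Definition Csin (z : C) : C := (Cexp (Ci * z) - Cexp (- (Ci * z))) / (2 * Ci).

Definition Ccos (z : C) : C := (Cexp (Ci * z) + Cexp (- (Ci * z))) / 2.

Definition Ctan (z : C) : C := Csin z / Ccos z.

(* Main.v *)
(* With b = -z, minus the n-th summand is the well-poised term t(0, n), where
     t(k, n) = (a + 2n) (a)_n (b)_n^2 (1/2)_n / (n! (k + 1)_n^2 (a + 1/2)_n),  a = k + b.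
   A WZ pair relates shifts in k: t(k, n) = rho_k t(k + 1, n) + g(k, n + 1) - g(k, n), and
   g(k, n) -> 0 precisely because Re z > -1/2; hence S_k = rho_k S_(k+1) for S_k = sum_n t(k, n).
   As k grows only the term n = 0 survives, S_k ~ k + b, so S_0 is b times the quotient of the
   products of 1 - b^2/(k + 1)^2 and of 1 - b^2/(k + 1/2)^2, that is, of Euler's products for
   sin(pi b)/(pi b) and cos(pi b).  Both come from the moments of cos(2bt) against cos^n t on
   [0, pi/2]: integration by parts gives a two-step recursion in n, the cases n = 0, 1 give sin
   and cos, and the normalized measure cos^n t dt concentrates at 0. *)
Require Import Defs.
From Stdlib Require Import Reals Lra Lia Psatz.
From Coquelicot Require Import Coquelicot.
Open Scope C_scope.

(** * Cosine moments *)

Local Open Scope R_scope.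

(** The shift in k is a contiguous relation of Dougall's very-well-poised 5F4 sum, which would give
    S_k = Gamma(k+1)^2 Gamma(k+b+1/2) Gamma(k+1/2-b) / (Gamma(k+b) Gamma(k+1-b) Gamma(k+1/2)^2);
    rho_k is the quotient of these values at k and k + 1. No Gamma function is formed: all products
    stay finite, and what they miss is an explicit factor tending to 1. Two obstacles shape the
    argument. To avoid interchanging a limit with a sum, one explicit majorant for large k yields
    both convergence and S_k = (k + b)(1 + O(1/k)); the WZ relation then carries convergence back to
    k = 0, whose series is never estimated directly. And b, k + b for small k, and the moments may
    all vanish, so identities are kept in multiplied form; the excluded half-integers keep the
    denominators of rho_k, and finally cos(pi b), away from 0. A complex b enters the real integrals
    through the two components of f(t) = cos(2bt), with f'' = -4 b^2 f and f'(0) = 0. *)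

Definition cosmoment (f : R -> R) (n : nat) : R :=
  RInt (fun t => cos t ^ n * f t) 0 (PI / 2).

Lemma continuous_cos_pow_mult (f : R -> R) (n : nat) (t : R) :
  continuous f t -> continuous (fun t => cos t ^ n * f t) t.
Proof.
intros Hf.
apply (continuous_mult (fun t => cos t ^ n) f); [|exact Hf].
apply (ex_derive_continuous (fun t : R => cos t ^ n)).
auto_derive; trivial.
Qed.

Lemma cosmoment_ex (f : R -> R) (n : nat) :
  (forall t, continuous f t) ->
  ex_RInt (fun t => cos t ^ n * f t) 0 (PI / 2).
Proof.
intros Hf; apply (ex_RInt_continuous (V := R_CompleteNormedModule)).
intros t _; now apply continuous_cos_pow_mult.
Qed.

Lemma continuous_lin (f g : R -> R) (p q t : R) :
  continuous f t -> continuous g t -> continuous (fun t => p * f t + q * g t) t.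
Proof.
intros Hf Hg; apply (continuous_plus (fun t => p * f t) (fun t => q * g t)).
- exact (continuous_mult (fun _ => p) f t (continuous_const p t) Hf).
- exact (continuous_mult (fun _ => q) g t (continuous_const q t) Hg).
Qed.

Lemma cosmoment_lin (f g : R -> R) (p q : R) (n : nat) :
  (forall t, continuous f t) -> (forall t, continuous g t) ->
  cosmoment (fun t => p * f t + q * g t) n = p * cosmoment f n + q * cosmoment g n.
Proof.
intros Hf Hg; unfold cosmoment; apply is_RInt_unique.
apply is_RInt_ext with (fun t => plus (scal p (cos t ^ n * f t)) (scal q (cos t ^ n * g t))).
{ intros t _; unfold plus, scal; simpl; unfold mult; simpl; ring. }
apply (is_RInt_plus (V := R_NormedModule));
  apply (is_RInt_scal (V := R_NormedModule)); apply (RInt_correct (V := R_CompleteNormedModule));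
  now apply cosmoment_ex.
Qed.

Lemma RInt_primitive (F h : R -> R) :
  (forall t, is_derive F t (h t)) -> (forall t, continuous h t) ->
  RInt h 0 (PI / 2) = F (PI / 2) - F 0.
Proof.
intros HF Hh; apply is_RInt_unique.
apply (is_RInt_derive (V := R_CompleteNormedModule) F h); intros; auto.
Qed.

Section TwiceDerivable.

Variables f f1 f2 : R -> R.
Hypothesis Df : forall t, is_derive f t (f1 t).
Hypothesis Df1 : forall t, is_derive f1 t (f2 t).
Hypothesis Cf2 : forall t, continuous f2 t.

Hypothesis f1_0 : f1 0 = 0.

Lemma twice_derivable_cont t : continuous f t.
Proof. apply (ex_derive_continuous f); eexists; apply Df. Qed.

Lemma cosmoment_deriv2_0 : cosmoment f2 0 = f1 (PI / 2).
Proof.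
pose proof (RInt_primitive f1 f2 Df1 Cf2) as E; rewrite f1_0, Rminus_0_r in E.
unfold cosmoment; rewrite <- E.
apply RInt_ext; intros; simpl; ring.
Qed.

Lemma cosmoment_deriv2_1 : cosmoment f 1 + cosmoment f2 1 = f (PI / 2).
Proof.
pose proof twice_derivable_cont as Cf.
rewrite <- (Rmult_1_l (cosmoment f 1)), <- (Rmult_1_l (cosmoment f2 1)),
  <- cosmoment_lin by auto.
unfold cosmoment.
rewrite (RInt_primitive (fun t => sin t * f t + cos t * f1 t)).
- rewrite sin_PI2, cos_PI2, sin_0, f1_0; ring.
- intros t; pose proof (Df t) as H; pose proof (Df1 t) as H1.
  auto_derive; [repeat split; eexists; eauto|].
  replace (Derive (fun x => f x) t) with (f1 t) by (symmetry; now apply is_derive_unique).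
  replace (Derive (fun x => f1 x) t) with (f2 t) by (symmetry; now apply is_derive_unique).
  ring.
- intros t; apply continuous_cos_pow_mult.
  apply continuous_lin; auto.
Qed.

(** Two integrations by parts, done at once by the primitive (m+2) cos^(m+1) t sin t f + cos^(m+2) t
    f'. After sin^2 = 1 - cos^2 its derivative is the difference of the integrands, and it vanishes
    at both ends because cos(pi/2) = sin 0 = f'(0) = 0. *)
Lemma cosmoment_rec (m : nat) :
  (INR m + 2) ^ 2 * cosmoment f (m + 2) + cosmoment f2 (m + 2)
    = (INR m + 2) * (INR m + 1) * cosmoment f m.
Proof.
pose proof twice_derivable_cont as Cf.
rewrite <- (Rmult_1_l (cosmoment f2 (m + 2))), <- cosmoment_lin by auto.
apply Rminus_diag_uniq; unfold cosmoment.
set (c := (INR m + 2) * (INR m + 1)).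
assert (E : c * RInt (fun t => cos t ^ m * f t) 0 (PI / 2)
  = RInt (fun t => scal c (cos t ^ m * f t)) 0 (PI / 2)).
{ symmetry; apply (RInt_scal (V := R_CompleteNormedModule)); now apply cosmoment_ex. }
rewrite E; clear E.
assert (C1 : forall t, continuous
   (fun t => cos t ^ (m + 2) * ((INR m + 2) ^ 2 * f t + 1 * f2 t)) t).
{ intros t; apply continuous_cos_pow_mult.
  apply continuous_lin; auto. }
assert (C2 : forall t, continuous (fun t => scal c (cos t ^ m * f t)) t).
{ intros t; apply (continuous_mult (fun _ => c) (fun t => cos t ^ m * f t) t); [apply continuous_const|].
  now apply continuous_cos_pow_mult. }
match goal with |- RInt ?g _ _ - RInt ?h _ _ = _ =>
  transitivity (RInt (fun t => minus (g t) (h t)) 0 (PI / 2)) end.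
{ symmetry; apply (RInt_minus (V := R_CompleteNormedModule));
  apply (ex_RInt_continuous (V := R_CompleteNormedModule)); auto. }
rewrite (RInt_primitive
  (fun t => (INR m + 2) * (cos t ^ (m + 1) * sin t * f t) + cos t ^ (m + 2) * f1 t)).
- rewrite cos_PI2, sin_0, !pow_ne_zero by lia.
  rewrite f1_0; ring.
- intros t; pose proof (Df t) as H; pose proof (Df1 t) as H1.
  auto_derive; [repeat split; eexists; eauto|].
  replace (Derive (fun x => f x) t) with (f1 t) by (symmetry; now apply is_derive_unique).
  replace (Derive (fun x => f1 x) t) with (f2 t) by (symmetry; now apply is_derive_unique).
  unfold minus, plus, opp, scal; simpl; unfold mult; simpl.
  replace (Init.Nat.pred (m + 1)) with m by lia.
  replace (Init.Nat.pred (m + 2)) with (m + 1)%nat by lia.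
  rewrite !plus_INR, !pow_add; unfold c; simpl.
  assert (Hs : sin t * sin t = 1 - cos t * cos t) by
    (pose proof (sin2_cos2 t); unfold Rsqr in *; lra).
  ring [Hs].
- intros t; apply (continuous_minus (V := R_NormedModule) (fun t => cos t ^ (m + 2) * ((INR m + 2) ^ 2 * f t + 1 * f2 t))); auto.
Qed.
End TwiceDerivable.

(** * Wallis integrals and concentration of the weight at 0 *)

Definition wallis (n : nat) : R := cosmoment (fun _ => 1) n.

Lemma wallis_0 : wallis 0 = PI / 2.
Proof.
unfold wallis, cosmoment.
rewrite (RInt_ext _ (fun _ => 1)) by (intros; simpl; ring).
rewrite RInt_const; unfold scal; simpl; unfold mult; simpl; ring.
Qed.

Lemma is_derive_cst (c : R) (t : R) : is_derive (fun _ : R => c) t 0.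
Proof. apply (is_derive_const (V := R_NormedModule)). Qed.

Lemma cosmoment_0 (n : nat) : cosmoment (fun _ => 0) n = 0.
Proof.
unfold cosmoment.
rewrite (RInt_ext _ (fun _ => 0)) by (intros; simpl; ring).
rewrite RInt_const; unfold scal; simpl; unfold mult; simpl; ring.
Qed.

Lemma wallis_1 : wallis 1 = 1.
Proof.
pose proof (cosmoment_deriv2_1 (fun _ => 1) (fun _ => 0) (fun _ => 0)
  (is_derive_cst 1) (is_derive_cst 0) (fun t => continuous_const 0 t) eq_refl) as H.
rewrite cosmoment_0 in H; unfold wallis; lra.
Qed.

Lemma wallis_rec (m : nat) : (INR m + 2) * wallis (m + 2) = (INR m + 1) * wallis m.
Proof.
pose proof (cosmoment_rec (fun _ => 1) (fun _ => 0) (fun _ => 0)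
  (is_derive_cst 1) (is_derive_cst 0) (fun t => continuous_const 0 t) eq_refl m) as H.
rewrite cosmoment_0 in H; fold (wallis (m + 2)) (wallis m) in H.
pose proof (pos_INR m); apply Rmult_eq_reg_l with (INR m + 2); lra.
Qed.

Lemma wallis_pos (n : nat) : 0 < wallis n.
Proof.
enough (H : 0 < wallis n /\ 0 < wallis (S n)) by apply H.
induction n as [|n [IH1 IH2]].
- rewrite wallis_0, wallis_1; pose proof PI_RGT_0; lra.
- split; [exact IH2|].
  pose proof (wallis_rec n) as H; replace (n + 2)%nat with (S (S n)) in H by lia.
  pose proof (pos_INR n); nra.
Qed.

(** The inequality t <= tan t freed of its division: sin t - t cos t vanishes at 0 and has
    derivative t sin t >= 0. *)
Lemma mul_cos_le_sin (t : R) : 0 <= t <= PI / 2 -> t * cos t <= sin t.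
Proof.
intros Ht.
destruct (MVT_gen (fun t => sin t - t * cos t) 0 t (fun t => t * sin t)) as [c [Hc E]].
- intros x _; auto_derive; trivial; ring.
- intros x _; apply continuity_pt_filterlim, (ex_derive_continuous (fun t => sin t - t * cos t)).
  auto_derive; trivial.
- rewrite Rmin_left, Rmax_right in Hc by lra.
  rewrite sin_0 in E.
  assert (0 <= sin c) by (apply sin_ge_0; pose proof PI_RGT_0; lra).
  assert (0 <= c * sin c * (t - 0)) by (repeat apply Rmult_le_pos; lra).
  lra.
Qed.

(** The mean value theorem, applied to f' and then to f. It gives K where Taylor's formula has K /
    2, which is enough for a rate. *)
Lemma taylor_bound (f f1 f2 : R -> R) (K T : R) :
  (forall t, is_derive f t (f1 t)) -> (forall t, is_derive f1 t (f2 t)) ->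
  f1 0 = 0 -> (forall t, 0 <= t <= T -> Rabs (f2 t) <= K) ->
  forall t, 0 <= t <= T -> Rabs (f t - f 0) <= K * t ^ 2.
Proof.
intros Df Df1 f10 HK.
assert (K0 : forall t, 0 <= t <= T -> 0 <= K).
{ intros t Ht; eapply Rle_trans; [apply Rabs_pos|]; apply (HK t Ht). }
assert (H1 : forall t, 0 <= t <= T -> Rabs (f1 t) <= K * t).
{ intros t Ht.
  destruct (MVT_gen f1 0 t f2) as [c [Hc E]]; auto.
  - intros x _; apply continuity_pt_filterlim, (ex_derive_continuous f1); eexists; apply Df1.
  - rewrite Rmin_left, Rmax_right in Hc by lra.
    replace (f1 t) with (f2 c * t) by lra.
    rewrite Rabs_mult, (Rabs_pos_eq t) by lra.
    apply Rmult_le_compat_r; [lra|]; apply HK; lra. }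
intros t Ht.
destruct (MVT_gen f 0 t f1) as [c [Hc E]]; auto.
- intros x _; apply continuity_pt_filterlim, (ex_derive_continuous f); eexists; apply Df.
- rewrite Rmin_left, Rmax_right in Hc by lra.
  rewrite E, Rabs_mult, Rminus_0_r, (Rabs_pos_eq t) by lra.
  assert (Rabs (f1 c) <= K * t).
  { eapply Rle_trans; [apply H1; lra|].
    apply Rmult_le_compat_l; [apply (K0 t)|]; lra. }
  replace (K * t ^ 2) with (K * t * t) by ring.
  apply Rmult_le_compat_r; lra.
Qed.

(* Since t cos t <= sin t, the weight cos^(m+2) t * t^2 is at most cos^m t - cos^(m+2) t. *)
Lemma cosmoment_concentration (f f1 f2 : R -> R) (K : R) (m : nat) :
  (forall t, is_derive f t (f1 t)) -> (forall t, is_derive f1 t (f2 t)) ->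
  f1 0 = 0 -> (forall t, 0 <= t <= PI / 2 -> Rabs (f2 t) <= K) ->
  Rabs (cosmoment f (m + 2) - f 0 * wallis (m + 2)) <= K / (INR m + 1) * wallis (m + 2).
Proof.
intros Df Df1 f10 HK.
pose proof PI_RGT_0 as Hpi.
assert (Cf : forall t, continuous f t) by
  (intros t; apply (ex_derive_continuous f); eexists; apply Df).
assert (C1 : forall t, continuous (fun _ : R => 1) t) by
  (intros t; apply continuous_const).
assert (Cd : forall t, continuous (fun t => 1 * f t + (- f 0) * 1) t) by
  (intros t; now apply (continuous_lin f (fun _ => 1))).
replace (cosmoment f (m + 2) - f 0 * wallis (m + 2))
  with (cosmoment (fun t => 1 * f t + (- f 0) * 1) (m + 2))
  by (rewrite (cosmoment_lin f (fun _ => 1)); trivial; unfold wallis; ring).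
(* By [wallis_rec], W(m) - W(m+2) = W(m+2) / (m+1), so the bound is the integral of K (cos^m -
   cos^(m+2)). *)
replace (K / (INR m + 1) * wallis (m + 2)) with (K * wallis m + - K * wallis (m + 2)).
2:{ pose proof (wallis_rec m); pose proof (pos_INR m).
    replace (wallis m) with ((INR m + 2) * wallis (m + 2) / (INR m + 1))
     by (rewrite H; field; lra).
    field; lra. }
eapply Rle_trans.
- apply (abs_RInt_le (fun t => cos t ^ (m + 2) * (1 * f t + (- f 0) * 1))); [lra|].
  now apply cosmoment_ex.
- unfold wallis, cosmoment.
  assert (E : forall n, ex_RInt (fun t => cos t ^ n * 1) 0 (PI / 2)) by
    (intros; now apply (cosmoment_ex (fun _ => 1))).
  transitivity (RInt (fun t => plus (scal K (cos t ^ m * 1)) (scal (- K) (cos t ^ (m + 2) * 1)))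
    0 (PI / 2)).
  + apply RInt_le; [lra| | |].
    * apply (ex_RInt_continuous (V := R_CompleteNormedModule)); intros t _.
      apply (continuous_comp (fun t => cos t ^ (m + 2) * (1 * f t + (- f 0) * 1)) Rabs).
      -- now apply continuous_cos_pow_mult.
      -- apply continuous_Rabs.
    * apply (ex_RInt_plus (V := R_NormedModule)); now apply (ex_RInt_scal (V := R_NormedModule)).
    * intros t Ht.
      assert (Hc : 0 <= cos t) by (apply cos_ge_0; lra).
      assert (H := taylor_bound f f1 f2 K (PI / 2) Df Df1 f10 HK t ltac:(lra)).
      assert (Hs := mul_cos_le_sin t ltac:(lra)).
      assert (HK0 : 0 <= K) by
        (eapply Rle_trans; [apply Rabs_pos|]; apply (HK t); lra).
      rewrite Rabs_mult, (Rabs_pos_eq (cos t ^ (m + 2))) by now apply pow_le.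
      unfold plus, scal; simpl; unfold mult; simpl.
      rewrite pow_add.
      replace (1 * f t + - f 0 * 1) with (f t - f 0) by ring.
      transitivity (cos t ^ m * (cos t ^ 2 * (K * t ^ 2))).
      { rewrite Rmult_assoc; apply Rmult_le_compat_l; [now apply pow_le|].
        apply Rmult_le_compat_l; [now apply pow_le|exact H]. }
      replace (K * (cos t ^ m * 1) + - K * (cos t ^ m * cos t ^ 2 * 1))
        with (cos t ^ m * (K * (1 - cos t ^ 2))) by ring.
      apply Rmult_le_compat_l; [now apply pow_le|].
      replace (1 - cos t ^ 2) with (sin t ^ 2) by
        (pose proof (sin2_cos2 t); unfold Rsqr in *; simpl; lra).
      replace (cos t ^ 2 * (K * t ^ 2)) with (K * (t * cos t) ^ 2) by ring.
      apply Rmult_le_compat_l; [exact HK0|].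
      apply pow_incr; split; [|exact Hs].
      apply Rmult_le_pos; lra.
  + rewrite (RInt_plus (V := R_CompleteNormedModule)).
    * rewrite !(RInt_scal (V := R_CompleteNormedModule)); auto.
      unfold plus, scal; simpl; unfold mult; simpl. lra.
    * now apply (ex_RInt_scal (V := R_NormedModule)).
    * now apply (ex_RInt_scal (V := R_NormedModule)).
Qed.

(* The real and imaginary parts of cos (2 b t), followed by their first two derivatives in t. *)
Definition cos_re (b : C) (t : R) : R :=
  (exp (2 * t * Im b) + exp (- (2 * t * Im b))) / 2 * cos (2 * t * Re b).
Definition cos_im (b : C) (t : R) : R :=
  (exp (- (2 * t * Im b)) - exp (2 * t * Im b)) / 2 * sin (2 * t * Re b).
Definition cos_re1 (b : C) (t : R) : R :=
  Im b * (exp (2 * t * Im b) - exp (- (2 * t * Im b))) * cos (2 * t * Re b)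
  - Re b * (exp (2 * t * Im b) + exp (- (2 * t * Im b))) * sin (2 * t * Re b).
Definition cos_im1 (b : C) (t : R) : R :=
  - Im b * (exp (2 * t * Im b) + exp (- (2 * t * Im b))) * sin (2 * t * Re b)
  + Re b * (exp (- (2 * t * Im b)) - exp (2 * t * Im b)) * cos (2 * t * Re b).
Definition cos_re2 (b : C) (t : R) : R :=
  - 4 * (Re b ^ 2 - Im b ^ 2) * cos_re b t + 8 * Re b * Im b * cos_im b t.
Definition cos_im2 (b : C) (t : R) : R :=
  - 4 * (Re b ^ 2 - Im b ^ 2) * cos_im b t + - 8 * Re b * Im b * cos_re b t.

Lemma is_derive_cos_re (b : C) (t : R) : is_derive (cos_re b) t (cos_re1 b t).
Proof. unfold cos_re, cos_re1; auto_derive; trivial; field. Qed.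
Lemma is_derive_cos_im (b : C) (t : R) : is_derive (cos_im b) t (cos_im1 b t).
Proof. unfold cos_im, cos_im1; auto_derive; trivial; field. Qed.
Lemma is_derive_cos_re1 (b : C) (t : R) : is_derive (cos_re1 b) t (cos_re2 b t).
Proof. unfold cos_re1, cos_re2, cos_re, cos_im; auto_derive; trivial; field. Qed.
Lemma is_derive_cos_im1 (b : C) (t : R) : is_derive (cos_im1 b) t (cos_im2 b t).
Proof. unfold cos_im1, cos_im2, cos_re, cos_im; auto_derive; trivial; field. Qed.

Lemma continuous_cos_re (b : C) (t : R) : continuous (cos_re b) t.
Proof. apply (ex_derive_continuous (cos_re b)); eexists; apply is_derive_cos_re. Qed.
Lemma continuous_cos_im (b : C) (t : R) : continuous (cos_im b) t.
Proof. apply (ex_derive_continuous (cos_im b)); eexists; apply is_derive_cos_im. Qed.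
Lemma continuous_cos_re2 (b : C) (t : R) : continuous (cos_re2 b) t.
Proof. apply continuous_lin; [apply continuous_cos_re|apply continuous_cos_im]. Qed.
Lemma continuous_cos_im2 (b : C) (t : R) : continuous (cos_im2 b) t.
Proof. apply continuous_lin; [apply continuous_cos_im|apply continuous_cos_re]. Qed.

Lemma cos_re1_0 (b : C) : cos_re1 b 0 = 0.
Proof.
unfold cos_re1; replace (2 * 0 * Im b) with 0 by ring; replace (2 * 0 * Re b) with 0 by ring.
rewrite Ropp_0, sin_0; ring.
Qed.
Lemma cos_im1_0 (b : C) : cos_im1 b 0 = 0.
Proof.
unfold cos_im1; replace (2 * 0 * Im b) with 0 by ring; replace (2 * 0 * Re b) with 0 by ring.
rewrite Ropp_0, sin_0; ring.
Qed.
Lemma cos_re_0 (b : C) : cos_re b 0 = 1.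
Proof.
unfold cos_re; replace (2 * 0 * Im b) with 0 by ring; replace (2 * 0 * Re b) with 0 by ring.
rewrite Ropp_0, exp_0, cos_0; field.
Qed.
Lemma cos_im_0 (b : C) : cos_im b 0 = 0.
Proof.
unfold cos_im; replace (2 * 0 * Im b) with 0 by ring; replace (2 * 0 * Re b) with 0 by ring.
rewrite Ropp_0, sin_0; ring.
Qed.

Definition cmoment (b : C) (n : nat) : C :=
  (cosmoment (cos_re b) n, cosmoment (cos_im b) n).

(** With [cosmoment_im2], the real form of the identity that the moment of f'' is -4 b^2 times that
    of f = cos(2bt), where -4 b^2 = -4 (x^2 - y^2) - 8 x y i. *)
Lemma cosmoment_re2 (b : C) (n : nat) :
  cosmoment (cos_re2 b) n = - 4 * (Re b ^ 2 - Im b ^ 2) * cosmoment (cos_re b) n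
     + 8 * Re b * Im b * cosmoment (cos_im b) n.
Proof. apply cosmoment_lin; [apply continuous_cos_re|apply continuous_cos_im]. Qed.
Lemma cosmoment_im2 (b : C) (n : nat) :
  cosmoment (cos_im2 b) n = - 4 * (Re b ^ 2 - Im b ^ 2) * cosmoment (cos_im b) n
     + - 8 * Re b * Im b * cosmoment (cos_re b) n.
Proof. apply cosmoment_lin; [apply continuous_cos_im|apply continuous_cos_re]. Qed.

Lemma Ccos_eq (x y : R) : Ccos (x, y) =
  ((exp y + exp (- y)) / 2 * cos x, (exp (- y) - exp y) / 2 * sin x).
Proof.
unfold Ccos, Cexp; simpl.
replace (0 * x - 1 * y) with (- y) by ring.
replace (0 * y + 1 * x) with x by ring.
rewrite cos_neg, sin_neg, Ropp_involutive.
apply injective_projections; simpl; field.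
Qed.

Lemma Csin_eq (x y : R) : Csin (x, y) =
  ((exp y + exp (- y)) / 2 * sin x, (exp y - exp (- y)) / 2 * cos x).
Proof.
unfold Csin, Cexp; simpl.
replace (0 * x - 1 * y) with (- y) by ring.
replace (0 * y + 1 * x) with x by ring.
rewrite cos_neg, sin_neg, Ropp_involutive.
apply injective_projections; simpl; field.
Qed.

Lemma cmoment_rec (b : C) (m : nat) :
  (((INR m + 2) ^ 2 - 4 * b ^ 2) * cmoment b (m + 2)
   = (INR m + 2) * (INR m + 1) * cmoment b m)%C.
Proof.
pose proof (cosmoment_rec _ _ _ (is_derive_cos_re b) (is_derive_cos_re1 b)
  (continuous_cos_re2 b) (cos_re1_0 b) m) as H1.
pose proof (cosmoment_rec _ _ _ (is_derive_cos_im b) (is_derive_cos_im1 b)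
  (continuous_cos_im2 b) (cos_im1_0 b) m) as H2.
rewrite cosmoment_re2 in H1; rewrite cosmoment_im2 in H2.
destruct b as [x y]; unfold cmoment; simpl Re in *; simpl Im in *.
apply injective_projections; simpl; ring_simplify; ring_simplify in H1; ring_simplify in H2; lra.
Qed.

(** Integrating f'' = -4 b^2 f gives -4 b^2 M_0 = f'(pi/2) = -2 b sin(pi b). The common factor b is
    kept here and cancelled in [Csin_cratio], where b = 0 is treated apart. *)
Lemma cmoment_0 (b : C) : (2 * b ^ 2 * cmoment b 0 = b * Csin (PI * b))%C.
Proof.
pose proof (cosmoment_deriv2_0 _ _ (is_derive_cos_re1 b)
  (continuous_cos_re2 b) (cos_re1_0 b)) as H1.
pose proof (cosmoment_deriv2_0 _ _ (is_derive_cos_im1 b)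
  (continuous_cos_im2 b) (cos_im1_0 b)) as H2.
rewrite cosmoment_re2 in H1; rewrite cosmoment_im2 in H2.
replace (PI * b)%C with ((PI * Re b)%R, (PI * Im b)%R)
  by (apply injective_projections; simpl; unfold Re, Im; ring).
rewrite Csin_eq.
unfold cos_re1, cos_im1 in *.
replace (2 * (PI / 2)) with PI in * by field.
destruct b as [x y]; unfold cmoment; simpl Re in *; simpl Im in *.
apply injective_projections; simpl; ring_simplify; ring_simplify in H1; ring_simplify in H2; lra.
Qed.

Lemma cmoment_1 (b : C) : ((1 - 4 * b ^ 2) * cmoment b 1 = Ccos (PI * b))%C.
Proof.
pose proof (cosmoment_deriv2_1 _ _ _ (is_derive_cos_re b) (is_derive_cos_re1 b)
  (continuous_cos_re2 b) (cos_re1_0 b)) as H1.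
pose proof (cosmoment_deriv2_1 _ _ _ (is_derive_cos_im b) (is_derive_cos_im1 b)
  (continuous_cos_im2 b) (cos_im1_0 b)) as H2.
rewrite cosmoment_re2 in H1; rewrite cosmoment_im2 in H2.
replace (PI * b)%C with ((PI * Re b)%R, (PI * Im b)%R)
  by (apply injective_projections; simpl; unfold Re, Im; ring).
rewrite Ccos_eq.
set (A := cosmoment (cos_re b) 1) in *.
set (B := cosmoment (cos_im b) 1) in *.
unfold cmoment; fold A B.
unfold cos_re, cos_im in H1, H2.
replace (2 * (PI / 2)) with PI in * by field.
clearbody A B; destruct b as [x y]; simpl Re in *; simpl Im in *.
apply injective_projections; simpl; ring_simplify; ring_simplify in H1; ring_simplify in H2; lra.
Qed.

Definition cratio (b : C) (n : nat) : C := (cmoment b n / wallis n)%C.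

Lemma continuous_bounded (f : R -> R) (a b : R) :
  a <= b -> (forall t, continuous f t) ->
  exists K, forall t, a <= t <= b -> Rabs (f t) <= K.
Proof.
intros Hab Cf.
destruct (continuity_ab_maj (fun t => Rabs (f t)) a b Hab) as [M [HM _]].
- intros c _; apply continuity_pt_filterlim.
  apply (continuous_comp f Rabs); [apply Cf|apply continuous_Rabs].
- exists (Rabs (f M)); exact HM.
Qed.

Lemma cratio_bound (b : C) :
  exists K, forall m, Cmod (cratio b (m + 2) - 1) <= K / (INR m + 1).
Proof.
pose proof PI_RGT_0.
destruct (continuous_bounded (cos_re2 b) 0 (PI / 2)) as [K1 H1];
  [lra|apply continuous_cos_re2|].
destruct (continuous_bounded (cos_im2 b) 0 (PI / 2)) as [K2 H2];
  [lra|apply continuous_cos_im2|].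
(* [Cmod] is at most sqrt 2 times the larger component, and K1 + K2 dominates the bounds of both. *)
exists (sqrt 2 * (K1 + K2)); intros m.
assert (HK1 : 0 <= K1) by (eapply Rle_trans; [apply Rabs_pos|apply (H1 0); lra]).
assert (HK2 : 0 <= K2) by (eapply Rle_trans; [apply Rabs_pos|apply (H2 0); lra]).
pose proof (wallis_pos (m + 2)) as HW; pose proof (pos_INR m) as Hm.
pose proof (cosmoment_concentration _ _ _ K1 m (is_derive_cos_re b) (is_derive_cos_re1 b)
  (cos_re1_0 b) H1) as E1.
pose proof (cosmoment_concentration _ _ _ K2 m (is_derive_cos_im b) (is_derive_cos_im1 b)
  (cos_im1_0 b) H2) as E2.
rewrite cos_re_0 in E1; rewrite cos_im_0 in E2.
set (W := wallis (m + 2)) in *.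
assert (HWC : RtoC W <> 0%C) by (intros h; apply RtoC_inj in h; lra).
assert (D : forall K x, 0 < W -> Rabs x <= K / (INR m + 1) * W -> Rabs (x / W) <= K / (INR m + 1)).
{ intros K x _ Hx; unfold Rdiv at 1; rewrite Rabs_mult, (Rabs_pos_eq (/ W)).
  - apply Rmult_le_reg_r with W; trivial; rewrite Rmult_assoc, Rinv_l; lra.
  - left; now apply Rinv_0_lt_compat. }
eapply Rle_trans; [apply Cmod_2Rmax|].
unfold Rdiv; rewrite Rmult_assoc; apply Rmult_le_compat_l; [apply sqrt_pos|].
assert (HI : 0 < / (INR m + 1)) by (apply Rinv_0_lt_compat; lra).
apply D in E1, E2; trivial.
apply Rmax_lub.
- replace (fst (cratio b (m + 2) - 1)%C) with ((cosmoment (cos_re b) (m + 2) - 1 * W) / W).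
  + unfold Rdiv in *; nra.
  + unfold cratio, cmoment, W; simpl; field; fold W; lra.
- replace (snd (cratio b (m + 2) - 1)%C) with ((cosmoment (cos_im b) (m + 2) - 0 * W) / W).
  + unfold Rdiv in *; nra.
  + unfold cratio, cmoment, W; simpl; field; fold W; lra.
Qed.

(** * The shifted series *)

Local Open Scope C_scope.

Fixpoint poch (w : C) (n : nat) : C :=
  match n with
  | O => 1
  | S k => poch w k * (w + INR k)
  end.

Lemma poch_neq_0 (w : C) (n : nat) : (forall j : nat, w + INR j <> 0) -> poch w n <> 0.
Proof.
intros Hw; induction n as [|n IH]; simpl; [apply C1_nz|].
now apply Cmult_neq_0.
Qed.

Lemma poch_shift (w : C) (n : nat) : w * poch (w + 1) n = poch w n * (w + INR n).
Proof.
induction n as [|n IH]; [simpl; ring|].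
change (poch (w + 1) (S n)) with (poch (w + 1) n * (w + 1 + INR n)).
change (poch w (S n)) with (poch w n * (w + INR n)).
rewrite Cmult_assoc, IH, S_INR, RtoC_plus; ring.
Qed.

(** With a = kappa + b, each lower parameter is 1 + a minus an upper one: 1 against a, kappa + 1
    against b (twice), a + 1/2 against 1/2. The term and its certificate are rational multiples of
    this quotient. *)
Definition poch_quotient (kappa : R) (b : C) (n : nat) : C :=
  poch (kappa + b) n * poch b n ^ 2 * poch (1 / 2) n
  / (poch 1 n * poch (kappa + 1) n ^ 2 * poch (kappa + b + 1 / 2) n).

Definition term (kappa : R) (b : C) (n : nat) : C :=
  (kappa + b + 2 * INR n) * poch_quotient kappa b n.

Definition shift_ratio (kappa : R) (b : C) : C :=
  (kappa + b) * (kappa + 1 - b) * (kappa + 1 / 2) ^ 2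
  / ((kappa + 1) ^ 2 * (kappa + b + 1 / 2) * (kappa + 1 / 2 - b)).

(** The factor n makes it vanish at n = 0, so that telescoping leaves only its behaviour at
    infinity. *)
Definition certificate (kappa : R) (b : C) (n : nat) : C :=
  - (INR n * (INR n + 2 * kappa + 1 / 2) / (kappa + 1 / 2 - b)) * poch_quotient kappa b n.

Lemma RtoC_neq_0 (x : R) : x <> 0%R -> RtoC x <> 0.
Proof. intros H h; apply H; now apply RtoC_inj. Qed.

Lemma two_neq_0 : RtoC 2 <> 0.
Proof. apply RtoC_neq_0; lra. Qed.

(* Side conditions of [field] come with halves cleared, hence the division of the goal by 2. *)
Ltac neq_0 :=
  repeat split; cbv beta; auto using two_neq_0;
  match goal with
  | H : ?x <> RtoC 0 |- ?y <> RtoC 0 =>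
    let E := fresh "E" in
    solve [ intros E; apply H; transitivity y; [ring | exact E]
          | intros E; apply H; transitivity (y / RtoC 2);
            [field; auto using two_neq_0 | rewrite E; unfold Cdiv; ring] ]
  end.

Section Shift.

Variables (kappa : R) (b : C).
Hypothesis kappa_ge : (0 <= kappa)%R.
Hypothesis Hplus : forall j : nat, kappa + b + 1 / 2 + INR j <> 0.
Hypothesis Hminus : kappa + 1 / 2 - b <> 0.

Lemma kappa_plus_neq_0 (x : R) (j : nat) : (0 < x)%R -> kappa + x + INR j <> 0.
Proof.
intros Hx; rewrite <- !RtoC_plus; apply RtoC_neq_0.
pose proof (pos_INR j); lra.
Qed.

Lemma one_plus_neq_0 (j : nat) : 1 + INR j <> 0.
Proof.
rewrite <- !RtoC_plus; apply RtoC_neq_0.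
pose proof (pos_INR j); lra.
Qed.

Lemma term_shift (n : nat) :
  term kappa b n = shift_ratio kappa b * term (kappa + 1) b n
    + (certificate kappa b (S n) - certificate kappa b n).
Proof.
unfold term, shift_ratio, certificate, poch_quotient.
rewrite !RtoC_plus, S_INR, RtoC_plus.
pose proof (poch_neq_0 1 n one_plus_neq_0) as N1.
pose proof (poch_neq_0 (kappa + 1) n (fun j => kappa_plus_neq_0 1 j Rlt_0_1)) as N2.
pose proof (poch_neq_0 _ n Hplus) as N3.
pose proof (one_plus_neq_0 n) as M1.
pose proof (kappa_plus_neq_0 1 n Rlt_0_1) as M2.
pose proof (Hplus n) as M3.
pose proof (kappa_plus_neq_0 1 0 Rlt_0_1) as L2.
pose proof (Hplus 0) as L3.
simpl INR in L2, L3; rewrite Cplus_0_r in L2, L3.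
pose proof (poch_shift (kappa + b) n) as S1.
pose proof (poch_shift (kappa + 1) n) as S2.
pose proof (poch_shift (kappa + b + 1 / 2) n) as S3.
replace (kappa + 1 + b) with (kappa + b + 1) by ring.
replace (kappa + b + 1 + 1 / 2) with (kappa + b + 1 / 2 + 1) by ring.
assert (E2 : poch (kappa + 1 + 1) n = poch (kappa + 1) n * (kappa + 1 + INR n) / (kappa + 1)).
{ rewrite <- S2; field; exact L2. }
assert (E3 : poch (kappa + b + 1 / 2 + 1) n
   = poch (kappa + b + 1 / 2) n * (kappa + b + 1 / 2 + INR n) / (kappa + b + 1 / 2)).
{ rewrite <- S3; field; neq_0. }
rewrite E2, E3; clear S2 S3 E2 E3.
(* Unlike the other shifted symbols, (a+1)_n = (a)_n (a+n) / a cannot be substituted, since a =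
   kappa + b may be 0. The factor a of [shift_ratio] is moved next to Q instead, and [S1] applies
   without division. *)
set (Q := poch (kappa + b + 1) n) in *.
simpl poch.
match goal with |- ?l = ?r * (?s * (Q * ?p * ?q / ?d)) + ?c =>
 transitivity ((kappa + b) * Q * ((kappa + 1 - b) * (kappa + 1 / 2) ^ 2 
  / ((kappa + 1) ^ 2 * (kappa + b + 1 / 2) * (kappa + 1 / 2 - b))) * (s * (p * q / d)) + c) end.
2:{ field; neq_0. }
rewrite S1; clear S1 Q.
field; neq_0.
Qed.

End Shift.

(** * Decay of the certificate *)

Lemma Cmod_plus_nat_sqr (al : C) (n : nat) :
  (Cmod (al + INR n) ^ 2 = (Re al + INR n) ^ 2 + Im al ^ 2)%R.
Proof. rewrite Cmod2_alt; destruct al; simpl; ring. Qed.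

(** The quotient of moduli is 1 + (Re al - Re be) / n + O(1/n^2), and eps absorbs the error. The
    exponential form lets such bounds multiply by adding exponents. Squares are compared, through 1
    + 2 y <= exp(2 y). *)
Lemma Cmod_ratio_exp (al be : C) (eps : R) :
  (0 < eps)%R ->
  eventually (fun n => (Cmod (al + INR n)
     <= exp ((Re al - Re be + eps) / INR n) * Cmod (be + INR n))%R).
Proof.
intros Heps.
set (c := (Re al - Re be)%R).
(* After clearing the denominator x = n, the difference of the two sides is 2 eps x^2 + p x + q; it
   is nonnegative once x >= 1 and 2 eps x >= |p| + |q|. *)
set (p := (Re be ^ 2 + Im be ^ 2 + (2 * c + 2 * eps) * (2 * Re be)
  - (Re al ^ 2 + Im al ^ 2))%R).
set (q := ((2 * c + 2 * eps) * (Re be ^ 2 + Im be ^ 2))%R).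
destruct (nfloor_ex ((Rabs p + Rabs q) / (2 * eps))) as [N [_ HN]].
{ apply Rdiv_le_0_compat; [|lra]; pose proof (Rabs_pos p); pose proof (Rabs_pos q); lra. }
exists (S N); intros n Hn.
apply le_INR in Hn; rewrite S_INR in Hn.
pose proof (pos_INR N).
set (x := INR n) in *.
assert (Hx : (Rabs p + Rabs q <= 2 * eps * x)%R).
{ apply Rlt_le, Rmult_lt_reg_r with (/ (2 * eps))%R; [apply Rinv_0_lt_compat; lra|].
  replace (2 * eps * x * / (2 * eps))%R with x by (field; lra).
  unfold Rdiv in HN; lra. }
apply Rsqr_incr_0_var.
2:{ apply Rmult_le_pos; [left; apply exp_pos|apply Cmod_ge_0]. }
unfold x; rewrite Rsqr_mult, !Rsqr_pow2, !Cmod_plus_nat_sqr; fold x c.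
apply Rle_trans with
  ((1 + 2 * ((c + eps) / x)) * ((Re be + x) ^ 2 + Im be ^ 2))%R.
- apply Rmult_le_reg_r with x; [lra|].
  replace ((1 + 2 * ((c + eps) / x)) * ((Re be + x) ^ 2 + Im be ^ 2) * x)%R
    with ((x + 2 * (c + eps)) * ((Re be + x) ^ 2 + Im be ^ 2))%R by (field; lra).
  apply Rminus_le_0.
  replace (_ - _)%R with (2 * eps * x * x + p * x + q)%R by (unfold p, q, c; ring).
  assert (- Rabs p <= p)%R by (pose proof (Rle_abs (- p)); rewrite Rabs_Ropp in *; lra).
  assert (- Rabs q <= q)%R by (pose proof (Rle_abs (- q)); rewrite Rabs_Ropp in *; lra).
  pose proof (Rabs_pos p); pose proof (Rabs_pos q).
  nra.
- apply Rmult_le_compat_r.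
  + pose proof (pow2_ge_0 (Re be + x)); pose proof (pow2_ge_0 (Im be)); lra.
  + replace (exp ((c + eps) / x) ^ 2)%R with (exp (2 * ((c + eps) / x))).
    * apply exp_ineq1_le.
    * simpl; rewrite Rmult_1_r, <- exp_plus; f_equal; ring.
Qed.

Lemma exp_le_compat (x y : R) : (x <= y)%R -> (exp x <= exp y)%R.
Proof.
intros [H| ->]; [left; now apply exp_increasing|apply Rle_refl].
Qed.

(** Since ln(n+1) - ln n <= 1/n, the accumulated factors exp(-d/n) are at most a constant times
    n^(-d). *)
Lemma seq_exp_decay (x : nat -> R) (d : R) :
  (0 < d)%R -> (forall n, (0 <= x n)%R) ->
  eventually (fun n => (x (S n) <= exp (- d / INR n) * x n)%R) ->
  is_lim_seq x 0.
Proof.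
intros Hd Hpos [N HN].
set (M := S N).
assert (HM : forall n, (x (M + n)%nat <= x M * exp (- d * (ln (INR (M + n)) - ln (INR M))))%R).
{ induction n as [|n IH].
  - rewrite Nat.add_0_r, Rminus_diag, Rmult_0_r, exp_0; lra.
  - rewrite Nat.add_succ_r.
    eapply Rle_trans; [apply HN; unfold M; lia|].
    eapply Rle_trans; [apply Rmult_le_compat_l; [left; apply exp_pos|exact IH]|].
    rewrite (Rmult_comm (x M)), <- Rmult_assoc, <- exp_plus, (Rmult_comm _ (x M)).
    apply Rmult_le_compat_l; [apply Hpos|].
    assert (H0 : (0 < INR (M + n))%R) by (apply lt_0_INR; unfold M; lia).
    assert (H : (ln (INR (S (M + n))) - ln (INR (M + n)) <= / INR (M + n))%R).
    { rewrite <- ln_div by (trivial; apply lt_0_INR; lia).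
      replace (INR (S (M + n)) / INR (M + n))%R with (1 + / INR (M + n))%R
        by (rewrite S_INR; field; lra).
      left; rewrite <- (ln_exp (/ INR (M + n))) at 2.
      apply ln_increasing; [|apply exp_ineq1];
      pose proof (Rinv_0_lt_compat _ H0); lra. }
    apply exp_le_compat; unfold Rdiv; nra. }
apply (is_lim_seq_incr_n x M).
apply is_lim_seq_le_le with (fun _ => 0%R)
  (fun n => (x M * exp (d * ln (INR M)) * exp (- d * ln (INR (n + M))))%R).
- intros n; split; [apply Hpos|].
  rewrite Nat.add_comm; eapply Rle_trans; [apply HM|].
  rewrite Rmult_assoc, <- exp_plus; right; do 2 f_equal; ring.
- apply is_lim_seq_const.
- rewrite <- (Rmult_0_r (x M * exp (d * ln (INR M)))).
  apply (is_lim_seq_scal_l _ _ 0).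
  apply (is_lim_comp_seq exp _ m_infty); [apply is_lim_exp_m|now exists 0%nat|].
  replace m_infty with (Rbar_mult (Finite (- d)) p_infty).
  + apply is_lim_seq_scal_l.
    apply (is_lim_comp_seq ln _ p_infty); [apply is_lim_ln_p|now exists 0%nat|].
    apply (is_lim_seq_incr_n INR M), is_lim_seq_INR.
  + apply is_Rbar_mult_unique, is_Rbar_mult_sym, is_Rbar_mult_p_infty_neg; simpl; lra.
Qed.

Section Certificate.

Variables (kappa : R) (b : C).
Hypothesis kappa_ge : (0 <= kappa)%R.
Hypothesis Hplus : forall j : nat, kappa + b + 1 / 2 + INR j <> 0.
Hypothesis Hminus : kappa + 1 / 2 - b <> 0.

(** The term ratio g(n+1) / g(n), cross-multiplied. Every factor is a constant plus n, including
    [0 + INR n], to match [Cmod_ratio_exp]. *)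
Lemma certificate_S (n : nat) : (0 < n)%nat ->
  certificate kappa b (S n)
  * ((2 * kappa + 1 / 2 + INR n) * (kappa + b + 1 / 2 + INR n) * (kappa + 1 + INR n) ^ 2
     * (0 + INR n))
  = certificate kappa b n
  * ((2 * kappa + 3 / 2 + INR n) * (kappa + b + INR n) * (b + INR n) ^ 2 * (1 / 2 + INR n)).
Proof.
intros Hn.
unfold certificate, poch_quotient; rewrite S_INR, RtoC_plus.
pose proof (poch_neq_0 1 n one_plus_neq_0) as N1.
pose proof (poch_neq_0 (kappa + 1) n (fun j => kappa_plus_neq_0 kappa kappa_ge 1 j Rlt_0_1)) as N2.
pose proof (poch_neq_0 _ n Hplus) as N3.
pose proof (one_plus_neq_0 n) as M1.
pose proof (kappa_plus_neq_0 kappa kappa_ge 1 n Rlt_0_1) as M2.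
pose proof (Hplus n) as M3.
simpl poch.
field; neq_0.
Qed.

Lemma certificate_lim : (2 * Re b < 1 + 2 * kappa)%R ->
  is_lim_seq (fun n => Cmod (certificate kappa b n)) 0.
Proof.
intros Hb.
(* The exponents add up to 1 - 1/2 + 2 (Re b - kappa - 1) + 1/2 = 2 Re b - 2 kappa - 1 = -10 e. Five
   comparisons, [R3] counting twice, cost e each, which leaves -5 e. *)
set (e := ((1 + 2 * kappa - 2 * Re b) / 10)%R).
assert (He : (0 < e)%R) by (unfold e; lra).
apply (seq_exp_decay _ (5 * e)); [lra|intros; apply Cmod_ge_0|].
pose proof (Cmod_ratio_exp (2 * kappa + 3 / 2) (2 * kappa + 1 / 2) e He) as R1.
pose proof (Cmod_ratio_exp (kappa + b) (kappa + b + 1 / 2) e He) as R2.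
pose proof (Cmod_ratio_exp b (kappa + 1) e He) as R3.
pose proof (Cmod_ratio_exp (1 / 2) 0 e He) as R4.
assert (R5 : eventually (fun n => (1 <= n)%nat)) by (exists 1%nat; auto).
generalize (filter_and _ _ R5 (filter_and _ _ (filter_and _ _ R1 R2) (filter_and _ _ R3 R4))).
apply filter_imp; clear R1 R2 R3 R4 R5; intros n [Hn [[R1 R2] [R3 R4]]].
assert (Hn' : (0 < INR n)%R) by (apply lt_0_INR; lia).
pose proof (certificate_S n Hn) as E.
apply (f_equal Cmod) in E.
rewrite !Cmod_mult, !Cmod_pow in E.
set (d1 := Cmod (2 * kappa + 1 / 2 + INR n)) in *.
set (d2 := Cmod (kappa + b + 1 / 2 + INR n)) in *.
set (d3 := Cmod (kappa + 1 + INR n)) in *.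
set (d4 := Cmod (0 + INR n)) in *.
set (n1 := Cmod (2 * kappa + 3 / 2 + INR n)) in *.
set (n2 := Cmod (kappa + b + INR n)) in *.
set (n3 := Cmod (b + INR n)) in *.
set (n4 := Cmod (1 / 2 + INR n)) in *.
set (X := Cmod (certificate kappa b (S n))) in *.
set (Y := Cmod (certificate kappa b n)) in *.
assert (D1 : (0 < d1)%R).
{ apply Cmod_gt_0; rewrite <- RtoC_mult, <- RtoC_div by lra; rewrite <- !RtoC_plus.
  apply RtoC_neq_0; lra. }
assert (D2 : (0 < d2)%R) by (apply Cmod_gt_0, Hplus).
assert (D3 : (0 < d3)%R) by (apply Cmod_gt_0, kappa_plus_neq_0; lra).
assert (D4 : (0 < d4)%R).
{ apply Cmod_gt_0; rewrite Cplus_0_l; apply RtoC_neq_0; lra. }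
assert (0 <= n1)%R by apply Cmod_ge_0.
assert (0 <= n2)%R by apply Cmod_ge_0.
assert (0 <= n3)%R by apply Cmod_ge_0.
assert (0 <= n4)%R by apply Cmod_ge_0.
assert (0 <= Y)%R by apply Cmod_ge_0.
apply Rmult_le_reg_r with (d1 * d2 * d3 ^ 2 * d4)%R;
  [repeat apply Rmult_lt_0_compat; trivial; lra|].
rewrite E.
match type of R1 with (_ <= exp ?x * _)%R => set (e1 := x) in * end.
match type of R2 with (_ <= exp ?x * _)%R => set (e2 := x) in * end.
match type of R3 with (_ <= exp ?x * _)%R => set (e3 := x) in * end.
match type of R4 with (_ <= exp ?x * _)%R => set (e4 := x) in * end.
replace (- (5 * e) / INR n)%R with (e1 + e2 + (e3 + e3) + e4)%R.
2:{ unfold e1, e2, e3, e4, e; destruct b; simpl; field; lra. }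
rewrite !exp_plus.
rewrite (Rmult_comm _ Y), (Rmult_assoc Y); apply Rmult_le_compat_l; trivial.
pose proof (exp_pos e1); pose proof (exp_pos e2); pose proof (exp_pos e3); pose proof (exp_pos e4).
replace (exp e1 * exp e2 * (exp e3 * exp e3) * exp e4 * (d1 * d2 * d3 ^ 2 * d4))%R
  with ((exp e1 * d1) * (exp e2 * d2) * (exp e3 * d3) ^ 2 * (exp e4 * d4))%R by ring.
repeat apply Rmult_le_compat; try apply pow_incr; repeat apply Rmult_le_pos; auto using pow_le with real.
Qed.

End Certificate.

(** * Domination of the terms for a large shift *)

Lemma Cmod_poch_le (al be : C) (n : nat) :
  (forall j : nat, Cmod (al + INR j) <= Cmod (be + INR j))%R ->
  (Cmod (poch al n) <= Cmod (poch be n))%R.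
Proof.
intros H; induction n as [|n IH]; simpl; [lra|].
rewrite !Cmod_mult; apply Rmult_le_compat; auto using Cmod_ge_0.
Qed.

Lemma Cmod_le_Re (x y : C) : (0 <= Re x <= Re y)%R -> Im x = Im y -> (Cmod x <= Cmod y)%R.
Proof.
intros Hr Hi; apply Rsqr_incr_0_var; [|apply Cmod_ge_0].
rewrite !Rsqr_pow2, !Cmod2_alt, Hi; nra.
Qed.

Section LargeShift.

Variables (kappa : R) (b : C).
Let B := (Cmod b + 1)%R.
Hypothesis kappa_large : (B + 1 <= kappa)%R.

Lemma B_ge : (1 <= B)%R.
Proof. unfold B; pose proof (Cmod_ge_0 b); lra. Qed.

Lemma Re_a_ge : (1 <= Re (kappa + b))%R.
Proof.
pose proof (re_le_Cmod b) as H; destruct b as [x y]; simpl in *.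
pose proof (Rle_abs (- x)) as H'; rewrite Rabs_Ropp in H'.
unfold B in *; lra.
Qed.

Lemma Cmod_a_ge : (1 <= Cmod (kappa + b))%R.
Proof.
eapply Rle_trans; [apply Re_a_ge|].
eapply Rle_trans; [apply Rle_abs|apply re_le_Cmod].
Qed.

Lemma Re_plus_real (x y : R) : Re (kappa + b + x + y) = (Re (kappa + b) + x + y)%R.
Proof. destruct b; simpl; ring. Qed.
Lemma Im_plus_real (x y : R) : Im (kappa + b + x + y) = Im (kappa + b).
Proof. destruct b; simpl; ring. Qed.

Lemma half_eq : 1 / 2 = RtoC (1 / 2)%R.
Proof. rewrite RtoC_div by lra; reflexivity. Qed.

Lemma a_half_neq_0 (j : nat) : kappa + b + 1 / 2 + INR j <> 0.
Proof.
intros E; apply (f_equal Re) in E; rewrite half_eq, Re_plus_real in E.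
pose proof Re_a_ge; pose proof (pos_INR j); simpl in E; simpl in *; lra.
Qed.

(** Factor by factor, |b + j| <= B + j and kappa + 1 + j >= B + 2 + j, and (B)_n / (B+2)_n = B (B+1)
    / ((B+n)(B+n+1)). The factor j = 0 keeps kappa + 1 instead of B + 2; this gains the decay in
    kappa and is why n starts at 1. *)
Lemma Cmod_poch_ratio (n : nat) : (1 <= n)%nat ->
  (Cmod (poch b n) <= B * (B + 1) * (B + 2) / (kappa + 1)
     / ((B + INR n) * (B + INR n + 1)) * Cmod (poch (kappa + 1) n))%R.
Proof.
pose proof B_ge as HB.
intros Hn; induction Hn as [|n Hn IH].
- simpl poch; rewrite !Cmult_1_l; change (INR 0) with 0%R; rewrite !Cplus_0_r.
  rewrite <- RtoC_plus, Cmod_R, Rabs_pos_eq by lra.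
  simpl INR.
  replace (B * (B + 1) * (B + 2) / (kappa + 1) / ((B + 1) * (B + 1 + 1)) * (kappa + 1))%R
   with B by (field; lra).
  unfold B; lra.
- simpl poch; rewrite !Cmod_mult.
  set (D := (B * (B + 1) * (B + 2) / (kappa + 1))%R) in *.
  set (Q := Cmod (poch (kappa + 1) n)) in *.
  pose proof (pos_INR n) as Hp.
  assert (HD : (0 <= D)%R).
  { apply Rdiv_le_0_compat; [|lra]; repeat apply Rmult_le_pos; lra. }
  assert (HQ : (0 <= Q)%R) by apply Cmod_ge_0.
  rewrite <- !RtoC_plus, Cmod_R, Rabs_pos_eq by lra.
  assert (H1 : (Cmod (b + INR n) <= B + INR n)%R).
  { eapply Rle_trans; [apply Cmod_triangle|].
    rewrite Cmod_R, Rabs_pos_eq by lra; unfold B; lra. }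
  eapply Rle_trans;
    [apply Rmult_le_compat; [apply Cmod_ge_0|apply Cmod_ge_0|exact IH|exact H1]|].
  rewrite S_INR.
  replace (D / ((B + INR n) * (B + INR n + 1)) * Q * (B + INR n))%R
    with (D / ((B + (INR n + 1)) * (B + (INR n + 1) + 1)) * (Q * (B + 2 + INR n)))%R
    by (field; lra).
  apply Rmult_le_compat_l.
  + apply Rdiv_le_0_compat; trivial; apply Rmult_lt_0_compat; lra.
  + apply Rmult_le_compat_l; trivial; lra.
Qed.

Lemma term_0 : term kappa b 0 = kappa + b.
Proof.
unfold term, poch_quotient; simpl; field; apply C1_nz.
Qed.

(** The square of (b)_n / (kappa+1)_n supplies all the decay, in n and in kappa. The other two
    quotients have modulus at most 1, as Re a > 0, and |a + 2m| <= |a| (1 + 2m) because |a| >= 1. *)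
Lemma term_bound (n : nat) :
  (Cmod (term kappa b (S n)) <=
    Cmod (kappa + b) * (B * (B + 1) * (B + 2) / (kappa + 1)) ^ 2
     * (2 / ((INR n + 1) * (INR n + 2))))%R.
Proof.
pose proof B_ge as HB; pose proof (pos_INR n) as Hn0; pose proof Cmod_a_ge as Ha.
assert (Hk : (0 <= kappa)%R) by lra.
set (m := S n); assert (Hm : INR m = (INR n + 1)%R) by apply S_INR.
assert (Hm1 : (1 <= m)%nat) by (unfold m; lia); clearbody m.
pose proof (poch_neq_0 1 m one_plus_neq_0) as N1.
pose proof (poch_neq_0 (kappa + 1) m (fun j => kappa_plus_neq_0 kappa Hk 1 j Rlt_0_1)) as N2.
pose proof (poch_neq_0 _ m a_half_neq_0) as N3.
unfold term, poch_quotient; rewrite Cmod_mult, Cmod_div, !Cmod_mult, !Cmod_pow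
  by (repeat apply Cmult_neq_0; auto using Cpow_nz, C1_nz).
pose proof (Cmod_poch_ratio m Hm1) as P1.
assert (P2 : (Cmod (poch (1 / 2) m) <= Cmod (poch 1 m))%R).
{ apply Cmod_poch_le; intros j; pose proof (pos_INR j).
  rewrite half_eq, <- !RtoC_plus, !Cmod_R, !Rabs_pos_eq; lra. }
assert (P3 : (Cmod (poch (kappa + b) m) <= Cmod (poch (kappa + b + 1 / 2) m))%R).
{ apply Cmod_poch_le; intros j; pose proof (pos_INR j); pose proof Re_a_ge.
  replace (kappa + b + INR j) with (kappa + b + 0%R + INR j) by ring.
  apply Cmod_le_Re; rewrite half_eq, ?Re_plus_real, ?Im_plus_real; [lra|easy]. }
assert (P4 : (Cmod (kappa + b + 2 * INR m) <= Cmod (kappa + b) * (1 + 2 * INR m))%R).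
{ eapply Rle_trans; [apply Cmod_triangle|].
  rewrite Cmod_mult, !Cmod_R, !Rabs_pos_eq by (rewrite ?Hm; lra); rewrite Hm; nra. }
apply Cmod_gt_0 in N1, N2, N3.
set (q1 := Cmod (poch 1 m)) in *.
set (q2 := Cmod (poch (kappa + 1) m)) in *.
set (q3 := Cmod (poch (kappa + b + 1 / 2) m)) in *.
set (D := (B * (B + 1) * (B + 2) / (kappa + 1))%R) in *.
assert (HD : (0 <= D)%R).
{ apply Rdiv_le_0_compat; [|lra]; repeat apply Rmult_le_pos; lra. }
set (s := ((B + INR m) * (B + INR m + 1))%R) in *.
assert (Hs : (0 < s)%R) by (apply Rmult_lt_0_compat; rewrite Hm; lra).
transitivity (Cmod (kappa + b) * (1 + 2 * INR m) * (q3 * (D / s * q2) ^ 2 * q1 / (q1 * q2 ^ 2 * q3)))%R.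
- apply Rmult_le_compat; trivial; [apply Cmod_ge_0| |].
  + apply Rdiv_le_0_compat; [|repeat apply Rmult_lt_0_compat; trivial; lra].
    repeat apply Rmult_le_pos; try apply Cmod_ge_0; lra.
  + apply Rmult_le_compat_r.
    * left; apply Rinv_0_lt_compat; repeat apply Rmult_lt_0_compat; trivial; lra.
    * apply Rmult_le_compat; auto using Rmult_le_pos, pow_le, Cmod_ge_0.
      apply Rmult_le_compat; auto using pow_le, Cmod_ge_0.
      apply pow_incr; split; [apply Cmod_ge_0|exact P1].
- replace (q3 * (D / s * q2) ^ 2 * q1 / (q1 * q2 ^ 2 * q3))%R with (D ^ 2 * / s ^ 2)%R
    by (field; lra).
  rewrite !Rmult_assoc; apply Rmult_le_compat_l; [lra|].
  rewrite (Rmult_comm (1 + _)), Rmult_assoc; apply Rmult_le_compat_l; [apply pow2_ge_0|].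
  (* Here m = n + 1; the second factor n + 2 absorbs 1 + 2m = 2n + 3 <= 2 (n + 2). *)
  assert (Hs2 : ((INR n + 1) * (INR n + 2) * (INR n + 2) <= s * s)%R).
  { assert (H1 : ((INR n + 1) * (INR n + 2) <= s)%R) by
      (unfold s; rewrite Hm; apply Rmult_le_compat; lra).
    assert (H2 : (INR n + 2 <= s)%R) by nra.
    apply Rmult_le_compat; trivial; try lra; apply Rmult_le_pos; lra. }
  apply Rmult_le_reg_l with (s * s * ((INR n + 1) * (INR n + 2)))%R;
    [repeat apply Rmult_lt_0_compat; trivial; lra|].
  replace (s * s * ((INR n + 1) * (INR n + 2)) * (/ s ^ 2 * (1 + 2 * INR m)))%R
    with ((INR n + 1) * (INR n + 2) * (1 + 2 * INR m))%R by (field; lra).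
  replace (s * s * ((INR n + 1) * (INR n + 2)) * (2 / ((INR n + 1) * (INR n + 2))))%R
    with (2 * (s * s))%R by (field; lra).
  rewrite Hm; nra.
Qed.

End LargeShift.

Lemma sum_telescoping_le (N : nat) :
  (sum_n (fun n => 2 / ((INR n + 1) * (INR n + 2))) N <= 2)%R.
Proof.
assert (E : (sum_n (fun n => 2 / ((INR n + 1) * (INR n + 2))) N = 2 - 2 / (INR N + 2))%R).
{ induction N as [|N IH].
  - rewrite sum_O; simpl; field.
  - rewrite sum_Sn, IH, S_INR; unfold plus; simpl; pose proof (pos_INR N); field; lra. }
rewrite E; pose proof (pos_INR N).
assert (0 < 2 / (INR N + 2))%R by (apply Rdiv_lt_0_compat; lra).
lra.
Qed.

(** One majorant, of total mass at most 2 D, gives both convergence and the distance of the sum from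
    its first term; this replaces an interchange of limit and sum. *)
Lemma series_le_telescoping (f : nat -> C) (D : R) :
  (0 <= D)%R ->
  (forall n, Cmod (f (S n)) <= D * (2 / ((INR n + 1) * (INR n + 2))))%R ->
  exists L : C, @is_series C_AbsRing C_NormedModule f L /\ (Cmod (L - f 0%nat) <= 2 * D)%R.
Proof.
intros HD Hf.
set (w := fun n : nat => (D * (2 / ((INR n + 1) * (INR n + 2))))%R).
assert (Hw0 : forall n, (0 <= 2 / ((INR n + 1) * (INR n + 2)))%R).
{ intros n; pose proof (pos_INR n); apply Rdiv_le_0_compat; [lra|].
  apply Rmult_lt_0_compat; lra. }
assert (Sw : forall N, (sum_n w N <= 2 * D)%R).
{ intros N; unfold w.
  rewrite (sum_n_mult_l (K := R_Ring) D (fun n => (2 / ((INR n + 1) * (INR n + 2)))%R)).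
  rewrite (Rmult_comm 2); apply Rmult_le_compat_l; [exact HD|apply sum_telescoping_le]. }
assert (Ew : ex_series w).
{ destruct (ex_finite_lim_seq_incr (sum_n w) (2 * D)) as [l Hl].
  - intros n; rewrite sum_Sn; unfold plus; simpl.
    pose proof (Hw0 (S n)); unfold w; nra.
  - exact Sw.
  - exists l; exact Hl. }
assert (Ex : exists l : C, @is_series C_AbsRing C_NormedModule (fun n => f (S n)) l)
  by exact (@ex_series_le C_AbsRing C_CompleteNormedModule (fun n => f (S n)) w Hf Ew).
destruct Ex as [l Hl].
exists (l + f 0%nat); split.
- apply (@is_series_decr_1 C_AbsRing C_NormedModule).
  replace (plus _ _) with l; [exact Hl|].
  change (l = l + f 0%nat + - f 0%nat); ring.
- replace (l + f 0%nat - f 0%nat) with (l : C) by ring.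
  assert (Hn : filterlim (fun N => Cmod (sum_n (G := C_AbelianMonoid) (fun n => f (S n)) N)) eventually
      (locally (Cmod l))).
  { apply (filterlim_comp _ _ _ _ (@norm C_AbsRing C_NormedModule) _ _ _ Hl).
    apply (@filterlim_norm C_AbsRing C_NormedModule). }
  apply (is_lim_seq_le _ (fun _ => (2 * D)%R) (Cmod l) (2 * D)%R) with (2 := Hn).
  + intros N; eapply Rle_trans; [|apply (Sw N)].
    eapply Rle_trans; [apply (@norm_sum_n_m C_AbsRing C_NormedModule)|].
    apply sum_n_m_le; exact Hf.
  + apply is_lim_seq_const.
Qed.

(** * Euler's products and the limit of the shifts *)

(** Convergence is expressed through a real sequence, so that the squeeze and arithmetic lemmas on
    real limits apply. *)
Definition Clim (u : nat -> C) (l : C) : Prop :=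
  is_lim_seq (fun n => Cmod (u n - l)) 0.

Lemma Clim_const (l : C) : Clim (fun _ => l) l.
Proof.
unfold Clim; apply (is_lim_seq_ext (fun _ => 0%R)); [|apply is_lim_seq_const].
intros _; rewrite <- Cmod_0; f_equal; ring.
Qed.

Lemma Clim_mult (u v : nat -> C) (l m : C) :
  Clim u l -> Clim v m -> Clim (fun n => u n * v n) (l * m).
Proof.
unfold Clim; intros Hu Hv.
apply is_lim_seq_le_le with (fun _ => 0%R)
  (fun n => (Cmod (u n - l) * Cmod (v n - m) + Cmod l * Cmod (v n - m)
     + Cmod m * Cmod (u n - l))%R).
- intros n; split; [apply Cmod_ge_0|].
  replace (u n * v n - l * m)
    with ((u n - l) * (v n - m) + l * (v n - m) + m * (u n - l)) by ring.
  rewrite <- !Cmod_mult.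
  eapply Rle_trans; [apply Cmod_triangle|]; apply Rplus_le_compat_r, Cmod_triangle.
- apply is_lim_seq_const.
- replace (Finite 0) with (Finite (0 * 0 + Cmod l * 0 + Cmod m * 0)%R) by (f_equal; ring).
  apply is_lim_seq_plus'; [apply is_lim_seq_plus'|];
    apply is_lim_seq_mult'; auto using is_lim_seq_const.
Qed.

Lemma Clim_unique (u : nat -> C) (l m : C) : Clim u l -> Clim u m -> l = m.
Proof.
unfold Clim; intros Hl Hm.
apply Ceq_minus, Cmod_eq_0.
apply Rle_antisym; [|apply Cmod_ge_0].
apply (is_lim_seq_le (fun _ => Cmod (l - m))
  (fun n => (Cmod (u n - l) + Cmod (u n - m))%R) (Cmod (l - m)) 0%R).
- intros n; rewrite <- (Cmod_opp (u n - l)).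
  replace (l - m) with (- (u n - l) + (u n - m)) by ring; apply Cmod_triangle.
- apply is_lim_seq_const.
- replace (Finite 0) with (Finite (0 + 0)%R) by (f_equal; ring).
  now apply is_lim_seq_plus'.
Qed.

Lemma lim_rate (K : R) : is_lim_seq (fun n => (K / (INR n + 1))%R) 0.
Proof.
replace (Finite 0) with (Rbar_mult K 0) by (simpl; f_equal; ring).
apply (is_lim_seq_scal_l _ K 0).
replace (Finite 0) with (Rbar_inv p_infty) by reflexivity.
apply is_lim_seq_inv; [|discriminate].
apply (is_lim_seq_ext (fun n => INR (S n))); [intros; apply S_INR|].
apply (is_lim_seq_incr_1 INR), is_lim_seq_INR.
Qed.

Lemma Clim_rate (u : nat -> C) (l : C) (K : R) :
  eventually (fun n => (Cmod (u n - l) <= K / (INR n + 1))%R) -> Clim u l.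
Proof.
intros H.
apply is_lim_seq_le_le_loc with (fun _ => 0%R) (fun n => (K / (INR n + 1))%R).
- revert H; apply filter_imp; intros n H; split; [apply Cmod_ge_0|exact H].
- apply is_lim_seq_const.
- apply lim_rate.
Qed.

Lemma cratio_lim (b : C) : Clim (cratio b) 1.
Proof.
destruct (cratio_bound b) as [K HK].
unfold Clim; apply (is_lim_seq_incr_n _ 2).
assert (H : Clim (fun n => cratio b (n + 2)) 1) by
  (apply Clim_rate with K; exists 0%nat; auto).
exact H.
Qed.

Lemma wallis_neq_0 (n : nat) : RtoC (wallis n) <> 0.
Proof. apply RtoC_neq_0; pose proof (wallis_pos n); lra. Qed.

(** Dividing [cmoment_rec] by [wallis_rec] leaves exactly one Euler factor: for m = 2k it is 1 -
    b^2/(k+1)^2, a factor of the sine product, and for m = 2k + 1 it is 1 - b^2/(k+3/2)^2, a factor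
    of the cosine product. *)
Lemma cratio_rec (b : C) (m : nat) :
  cratio b m = (1 - 4 * b ^ 2 / (INR m + 2) ^ 2) * cratio b (m + 2).
Proof.
pose proof (cmoment_rec b m) as H; pose proof (wallis_rec m) as HW.
apply (f_equal RtoC) in HW; rewrite !RtoC_mult, !RtoC_plus in HW.
pose proof (wallis_neq_0 m) as W0; pose proof (wallis_neq_0 (m + 2)) as W2.
pose proof (pos_INR m).
assert (N1 : INR m + 1 <> 0) by (rewrite <- RtoC_plus; apply RtoC_neq_0; lra).
assert (N2 : INR m + 2 <> 0) by (rewrite <- RtoC_plus; apply RtoC_neq_0; lra).
unfold cratio.
replace (cmoment b m) with
  (((INR m + 2) ^ 2 - 4 * b ^ 2) * cmoment b (m + 2) / ((INR m + 2) * (INR m + 1)))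
  by (rewrite H; field; auto).
replace (RtoC (wallis m)) with ((INR m + 2) * wallis (m + 2) / (INR m + 1))
  by (rewrite HW; field; auto).
field; auto.
Qed.

Lemma Csin_cratio (b : C) : Csin (PI * b) = PI * b * cratio b 0.
Proof.
assert (HP : RtoC PI <> 0) by (apply RtoC_neq_0, PI_neq0).
unfold cratio; rewrite wallis_0, RtoC_div by lra.
destruct (Ceq_dec b 0) as [Hb|Hb].
- rewrite Hb, !Cmult_0_r, (Csin_eq 0 0 : Csin 0 = _), sin_0, Ropp_0, exp_0.
  apply injective_projections; simpl; field; apply PI_neq0.
- pose proof (cmoment_0 b) as H.
  replace (Csin (PI * b)) with (2 * b * cmoment b 0).
  + field; auto.
  + transitivity (2 * b ^ 2 * cmoment b 0 / b); [field; auto|].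
    rewrite H; field; auto.
Qed.

Lemma Ccos_cratio (b : C) : Ccos (PI * b) = (1 - 4 * b ^ 2) * cratio b 1.
Proof.
unfold cratio; rewrite wallis_1, <- cmoment_1; field; apply C1_nz.
Qed.

Fixpoint sin_prod (b : C) (n : nat) : C :=
  match n with
  | O => 1
  | S k => sin_prod b k * (1 - b ^ 2 / (INR k + 1) ^ 2)
  end.

Fixpoint cos_prod (b : C) (n : nat) : C :=
  match n with
  | O => 1
  | S k => cos_prod b k * (1 - b ^ 2 / (INR k + 1 / 2) ^ 2)
  end.

(** Exact for every n: the moment ratio is the remainder of Euler's product. *)
Lemma Csin_prod (b : C) (n : nat) :
  Csin (PI * b) = PI * b * sin_prod b n * cratio b (2 * n).
Proof.
induction n as [|n IH].
- simpl sin_prod; rewrite Csin_cratio; simpl; ring.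
- rewrite IH, cratio_rec.
  change (sin_prod b (S n)) with (sin_prod b n * (1 - b ^ 2 / (INR n + 1) ^ 2)).
  replace (2 * S n)%nat with (2 * n + 2)%nat by lia.
  rewrite mult_INR, RtoC_mult; simpl (INR 2).
  replace (4 * b ^ 2 / (RtoC (1 + 1) * INR n + 2) ^ 2) with (b ^ 2 / (INR n + 1) ^ 2); [ring|].
  pose proof (one_plus_neq_0 n) as M1.
  rewrite RtoC_plus; field; neq_0.
Qed.

(** The cosine product is one factor ahead of the sine product, as [Ccos_cratio] already contains 1
    - 4 b^2, the factor of index 0. *)
Lemma Ccos_prod (b : C) (n : nat) :
  Ccos (PI * b) = cos_prod b (S n) * cratio b (S (2 * n)).
Proof.
induction n as [|n IH].
- simpl cos_prod; rewrite Ccos_cratio; simpl (S (2 * 0)).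
  f_equal; simpl INR; field.
- rewrite IH, cratio_rec.
  change (cos_prod b (S (S n))) with (cos_prod b (S n) * (1 - b ^ 2 / (INR (S n) + 1 / 2) ^ 2)).
  replace (S (2 * S n))%nat with (S (2 * n) + 2)%nat by lia.
  rewrite !S_INR, mult_INR, !RtoC_plus, RtoC_mult; simpl (INR 2).
  replace (4 * b ^ 2 / (RtoC (1 + 1) * INR n + 1 + 2) ^ 2)
    with (b ^ 2 / (INR n + 1 + 1 / 2) ^ 2); [ring|].
  pose proof (pos_INR n).
  assert (M1 : 2 * INR n + 3 <> 0).
  { rewrite <- RtoC_mult, <- RtoC_plus; apply RtoC_neq_0; lra. }
  rewrite RtoC_plus; field; neq_0.
Qed.

Local Notation is_Cseries := (@is_series C_AbsRing C_NormedModule).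

(** The error is relative to c(n) because the sums of the shifted series are known only up to a
    factor 1 + O(1/n). *)
Lemma Clim_relative (c v : nat -> C) (l : C) (K : R) :
  Clim c l -> eventually (fun n => (Cmod (v n - c n) <= Cmod (c n) * (K / (INR n + 1)))%R) ->
  Clim v l.
Proof.
unfold Clim; intros Hc Hv.
apply is_lim_seq_le_le_loc with (fun _ => 0%R)
  (fun n => ((Cmod l + Cmod (c n - l)) * (Rabs K / (INR n + 1)) + Cmod (c n - l))%R).
- revert Hv; apply filter_imp; intros n Hn; split; [apply Cmod_ge_0|].
  replace (v n - l) with ((v n - c n) + (c n - l)) by ring.
  eapply Rle_trans; [apply Cmod_triangle|]; apply Rplus_le_compat_r.
  eapply Rle_trans; [exact Hn|].
  assert (H : (0 < / (INR n + 1))%R) by (apply Rinv_0_lt_compat; pose proof (pos_INR n); lra).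
  apply Rle_trans with (Cmod (c n) * (Rabs K / (INR n + 1)))%R.
  + apply Rmult_le_compat_l; [apply Cmod_ge_0|].
    apply Rmult_le_compat_r; [lra|apply Rle_abs].
  + apply Rmult_le_compat_r.
    * apply Rmult_le_pos; [apply Rabs_pos|lra].
    * replace (c n) with (l + (c n - l)) at 1 by ring; apply Cmod_triangle.
- apply is_lim_seq_const.
- replace (Finite 0) with (Finite ((Cmod l + 0) * 0 + 0)%R) by (f_equal; ring).
  apply is_lim_seq_plus'; [|exact Hc].
  apply is_lim_seq_mult'; [|apply lim_rate].
  apply is_lim_seq_plus'; [apply is_lim_seq_const|exact Hc].
Qed.

Lemma is_Cseries_unique (f : nat -> C) (l m : C) :
  is_Cseries f l -> is_Cseries f m -> l = m.
Proof.
apply (@filterlim_locally_unique _ C_AbsRing C_NormedModule eventually _).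
Qed.

(** Convergence is part of the conclusion: it passes from the shifted series t' to t, since the
    partial sums of the differences of g are g(N+1). *)
Lemma is_Cseries_shift (t t' g : nat -> C) (r L : C) :
  (forall n, t n = r * t' n + (g (S n) - g n)) -> g 0%nat = 0 ->
  is_lim_seq (fun n => Cmod (g n)) 0 ->
  is_Cseries t' L -> is_Cseries t (r * L).
Proof.
intros Ht Hg0 Hg HL.
apply (@is_series_ext C_AbsRing C_NormedModule (fun n => plus (scal r (t' n)) (g (S n) - g n))).
{ intros n; symmetry; apply Ht. }
replace (r * L) with (plus (scal r L) (0 : C)) by (apply Cplus_0_r).
apply (@is_series_plus C_AbsRing C_NormedModule).
- now apply (@is_series_scal C_AbsRing C_NormedModule).
- apply (filterlim_ext (fun N => g (S N))).
  + induction x as [|N IH].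
    * rewrite sum_O, Hg0; change (g 1%nat = g 1%nat - 0); ring.
    * rewrite sum_Sn, <- IH.
      change (g (S (S N)) = g (S N) + (g (S (S N)) - g (S N))); ring.
  + apply (@filterlim_norm_zero _ C_AbsRing C_NormedModule eventually _).
    exact (proj1 (is_lim_seq_incr_1 (fun n => Cmod (g n)) 0) Hg).
Qed.

(** * Evaluation of the unshifted series *)

Section Evaluation.

Variable b : C.
Hypothesis Hb : (Re b < 1 / 2)%R.
Hypothesis Hhalf : forall k : Z, b <> 1 / 2 + IZR k.

Lemma half_plus_neq_0 (n : nat) : INR n + 1 / 2 + b <> 0.
Proof.
intros E; apply (Hhalf (- Z.of_nat n - 1)).
rewrite minus_IZR, opp_IZR, <- INR_IZR_INZ, RtoC_minus, RtoC_opp.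
transitivity (INR n + 1 / 2 + b - INR n - 1 / 2); [ring|rewrite E; field].
Qed.

Lemma half_minus_neq_0 (n : nat) : INR n + 1 / 2 - b <> 0.
Proof.
intros E; apply (Hhalf (Z.of_nat n)).
rewrite <- INR_IZR_INZ.
transitivity (INR n + 1 / 2 - (INR n + 1 / 2 - b)); [ring|rewrite E; ring].
Qed.

Lemma a_plus_half_neq_0 (n j : nat) : INR n + b + 1 / 2 + INR j <> 0.
Proof.
intros E; apply (half_plus_neq_0 (n + j)); rewrite plus_INR, RtoC_plus.
rewrite <- E; ring.
Qed.

Lemma term_series_step (n : nat) (L : C) :
  is_Cseries (term (INR (S n)) b) L ->
  is_Cseries (term (INR n) b) (shift_ratio (INR n) b * L).
Proof.
rewrite S_INR; pose proof (pos_INR n).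
apply is_Cseries_shift with (certificate (INR n) b).
- intros j; apply term_shift; trivial.
  + intros i; apply a_plus_half_neq_0.
  + apply half_minus_neq_0.
- unfold certificate; simpl; unfold Cdiv; ring.
- apply certificate_lim; trivial.
  + intros i; apply a_plus_half_neq_0.
  + apply half_minus_neq_0.
  + lra.
Qed.

Fixpoint shift_prod (n : nat) : C :=
  match n with
  | O => 1
  | S k => shift_prod k * shift_ratio (INR k) b
  end.

Lemma term_series_chain (n : nat) (L : C) :
  is_Cseries (term (INR n) b) L -> is_Cseries (term 0 b) (shift_prod n * L).
Proof.
revert L; induction n as [|n IH]; intros L HL.
- simpl shift_prod; rewrite Cmult_1_l; exact HL.
- simpl shift_prod; rewrite <- Cmult_assoc; apply IH, term_series_step, HL.
Qed.

(** The factors k + b for k < n, together with n + b, are b times the factors k + 1 + b; these pair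
    with k + 1 - b into (k+1)^2 - b^2. Multiplying by [cos_prod] avoids division. *)
Lemma shift_prod_eq (n : nat) :
  shift_prod n * (INR n + b) * cos_prod b n = b * sin_prod b n.
Proof.
induction n as [|n IH].
- simpl; ring.
- change (sin_prod b (S n)) with (sin_prod b n * (1 - b ^ 2 / (INR n + 1) ^ 2)).
  change (cos_prod b (S n)) with (cos_prod b n * (1 - b ^ 2 / (INR n + 1 / 2) ^ 2)).
  change (shift_prod (S n)) with (shift_prod n * shift_ratio (INR n) b).
  rewrite (Cmult_assoc b), <- IH, S_INR, RtoC_plus; unfold shift_ratio.
  pose proof (pos_INR n).
  pose proof (one_plus_neq_0 n) as M1.
  pose proof (half_plus_neq_0 n) as M2.
  pose proof (half_minus_neq_0 n) as M3.
  assert (M4 : INR n + 1 / 2 <> 0).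
  { rewrite half_eq, <- RtoC_plus; apply RtoC_neq_0; lra. }
  field; neq_0.
Qed.

Lemma large_shift_series : exists (N : nat) (K : R), forall n : nat, (N <= n)%nat ->
  INR n + b <> 0 /\
  exists L : C, is_Cseries (term (INR n) b) L /\
    (Cmod (L / (INR n + b) - 1) <= K / (INR n + 1))%R.
Proof.
set (B := (Cmod b + 1)%R).
destruct (nfloor_ex (B + 1)) as [N [_ HN]].
{ unfold B; pose proof (Cmod_ge_0 b); lra. }
(* The tail bound 2 D divided by |n + b| is this constant over (n+1)^2; one factor 1/(n+1) is given
   up. *)
exists (S N), (2 * (B * (B + 1) * (B + 2)) ^ 2)%R; intros n Hn.
apply le_INR in Hn; rewrite S_INR in Hn.
assert (Hk : (B + 1 <= INR n)%R) by lra.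
pose proof (pos_INR n); pose proof (Cmod_a_ge _ _ Hk) as Ha.
assert (Na : INR n + b <> 0) by (apply Cmod_gt_0; lra).
split; [exact Na|].
set (D := (Cmod (INR n + b) * (B * (B + 1) * (B + 2) / (INR n + 1)) ^ 2)%R).
destruct (series_le_telescoping (term (INR n) b) D) as [L [HL E]].
- apply Rmult_le_pos; [lra|apply pow2_ge_0].
- intros j; apply (term_bound _ _ Hk).
- exists L; split; [exact HL|].
  rewrite term_0 in E.
  replace (L / (INR n + b) - 1) with ((L - (INR n + b)) / (INR n + b)) by (field; exact Na).
  rewrite Cmod_div by exact Na.
  apply Rmult_le_reg_r with (Cmod (INR n + b)); [lra|].
  unfold Rdiv at 1; rewrite Rmult_assoc, Rinv_l, Rmult_1_r by lra.
  eapply Rle_trans; [exact E|]; unfold D.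
  set (beta := (B * (B + 1) * (B + 2))%R).
  replace (2 * (Cmod (INR n + b) * (beta / (INR n + 1)) ^ 2))%R
    with (2 * beta ^ 2 / (INR n + 1) * Cmod (INR n + b) * / (INR n + 1))%R by (field; lra).
  rewrite <- (Rmult_1_r (_ * Cmod _)) at 2.
  apply Rmult_le_compat_l.
  + apply Rmult_le_pos; [|lra].
    apply Rdiv_le_0_compat; [|lra]; pose proof (pow2_ge_0 beta); lra.
  + rewrite <- Rinv_1; apply Rinv_le_contravar; lra.
Qed.

Lemma last_factor_lim : Clim (fun n => 1 - b ^ 2 / (INR n + 1 / 2) ^ 2) 1.
Proof.
apply Clim_rate with (4 * Cmod b ^ 2)%R; exists 0%nat; intros n _.
pose proof (pos_INR n).
assert (M4 : INR n + 1 / 2 <> 0).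
{ rewrite half_eq, <- RtoC_plus; apply RtoC_neq_0; lra. }
replace (1 - b ^ 2 / (INR n + 1 / 2) ^ 2 - 1) with (- (b ^ 2 / (INR n + 1 / 2) ^ 2)) by ring.
rewrite Cmod_opp, Cmod_div, !Cmod_pow by now apply Cpow_nz.
rewrite half_eq, <- RtoC_plus, Cmod_R, Rabs_pos_eq by lra.
unfold Rdiv at 1 3; rewrite (Rmult_comm 4), Rmult_assoc; apply Rmult_le_compat_l;
  [apply pow2_ge_0|].
(* The constant 4 comes from (n + 1/2)^2 >= (n + 1) / 4, sharp at n = 0. *)
replace (4 * / (INR n + 1))%R with (/ ((INR n + 1) / 4))%R by (field; lra).
apply Rinv_le_contravar; nra.
Qed.

Lemma term_series_eval :
  exists S : C, is_Cseries (term 0 b) S /\ S * (PI * Ccos (PI * b)) = Csin (PI * b).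
Proof.
destruct large_shift_series as [N [K HK]].
destruct (HK N (le_n N)) as [_ [L0 [HL0 _]]].
set (S := shift_prod N * L0).
assert (HS : is_Cseries (term 0 b) S) by now apply term_series_chain.
exists S; split; [exact HS|].
(* Multiplying by [cratio b (2 * n)] completes the sine product, so nothing is divided by a moment
   ratio, which may vanish. The constant is then the limit of sin(pi b) times three factors tending
   to 1: the extra cosine factor, [cratio b (2n + 1)] and L / (n + b). *)
assert (Hlim : Clim (fun n => S * (PI * Ccos (PI * b)) * cratio b (2 * n))
  (S * (PI * Ccos (PI * b)) * 1)).
{ apply Clim_mult; [apply Clim_const|].
  apply (is_lim_seq_subseq (fun n => Cmod (cratio b n - 1)) 0 (fun n => (2 * n)%nat)); [|apply cratio_lim].
  apply eventually_subseq; intros; lia. }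
rewrite Cmult_1_r in Hlim; apply (Clim_unique _ _ _ Hlim).
- assert (Hw : Clim (fun n => (1 - b ^ 2 / (INR n + 1 / 2) ^ 2) * cratio b (Datatypes.S (2 * n)))
    (1 * 1)).
  { apply Clim_mult; [apply last_factor_lim|].
    apply (is_lim_seq_subseq (fun n => Cmod (cratio b n - 1)) 0 (fun n => Datatypes.S (2 * n)%nat));
      [|apply cratio_lim].
    apply eventually_subseq; intros; lia. }
  rewrite (Cmult_1_r 1) in Hw.
  rewrite <- (Cmult_1_r (Csin _)).
  apply Clim_relative with (K := K)
    (c := fun n => Csin (PI * b) * ((1 - b ^ 2 / (INR n + 1 / 2) ^ 2) * cratio b (Datatypes.S (2 * n)))).
  + apply Clim_mult; [apply Clim_const|exact Hw].
  + exists N; intros n Hn; destruct (HK n Hn) as [Na [L [HL E]]].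
    (* The chain may start from any large n: uniqueness of sums identifies the result with the fixed
       S. *)
    pose proof (is_Cseries_unique _ _ _ HS (term_series_chain _ _ HL)) as ->.
    match goal with |- (Cmod (?v - ?c) <= _)%R =>
      replace (v - c) with (c * (L / (INR n + b) - 1)) end.
    { rewrite Cmod_mult; apply Rmult_le_compat_l; [apply Cmod_ge_0|exact E]. }
    rewrite (Ccos_prod b n), (Csin_prod b n).
    change (cos_prod b (Datatypes.S n)) with (cos_prod b n * (1 - b ^ 2 / (INR n + 1 / 2) ^ 2)).
    set (w := 1 - b ^ 2 / (INR n + 1 / 2) ^ 2).
    pose proof (shift_prod_eq n) as HP.
    transitivity (b * sin_prod b n * (PI * cratio b (2 * n) * w
       * cratio b (Datatypes.S (2 * n)) * (L / (INR n + b) - 1))); [ring|].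
    transitivity ((b * sin_prod b n) * (L / (INR n + b)) * PI * w * cratio b (2 * n)
       * cratio b (Datatypes.S (2 * n))
      - b * sin_prod b n * PI * w * cratio b (2 * n) * cratio b (Datatypes.S (2 * n))); [ring|].
    rewrite <- HP at 1; field; exact Na.
Qed.

(** For pi b = x + i y, a zero forces cosh y cos x = 0, so cos x = 0 and sin x is nonzero; then sinh
    y = 0, and b is a real half-integer. *)
Lemma Ccos_PI_neq_0 : Ccos (PI * b) <> 0.
Proof.
replace (PI * b) with ((PI * Re b)%R, (PI * Im b)%R)
  by (apply injective_projections; simpl; unfold Re, Im; ring).
rewrite Ccos_eq; intros E; injection E as E1 E2.
pose proof PI_RGT_0.
pose proof (exp_pos (PI * Im b)); pose proof (exp_pos (- (PI * Im b))).
apply Rmult_integral in E1; destruct E1 as [E1|E1]; [lra|].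
apply Rmult_integral in E2; destruct E2 as [E2|E2].
2:{ pose proof (sin2_cos2 (PI * Re b)) as H2; rewrite E1, E2 in H2; unfold Rsqr in H2; lra. }
assert (Hy : Im b = 0%R).
{ assert (H3 : exp (- (PI * Im b)) = exp (PI * Im b)) by lra.
  apply exp_inv in H3; nra. }
apply cos_eq_0_0 in E1; destruct E1 as [k Hk].
apply (Hhalf k).
assert (Hx : Re b = (1 / 2 + IZR k)%R) by (apply Rmult_eq_reg_l with PI; lra).
rewrite half_eq, <- RtoC_plus, <- Hx.
apply injective_projections; simpl; [reflexivity|exact Hy].
Qed.

End Evaluation.

Lemma Csin_opp (w : C) : Csin (- w) = - Csin w.
Proof.
unfold Csin; replace (- (Ci * - w)) with (Ci * w) by ring.
replace (Ci * - w) with (- (Ci * w)) by ring.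
unfold Cdiv; ring.
Qed.

Lemma Ccos_opp (w : C) : Ccos (- w) = Ccos w.
Proof.
unfold Ccos; replace (- (Ci * - w)) with (Ci * w) by ring.
replace (Ci * - w) with (- (Ci * w)) by ring.
unfold Cdiv; ring.
Qed.

(** * Translation to binomial coefficients *)

Lemma Cfalling_poch (w : C) (n : nat) : Cfalling w n = (-1) ^ n * poch (- w) n.
Proof.
induction n as [|n IH]; simpl; [ring|rewrite IH; ring].
Qed.

Lemma fact_poch (n : nat) : RtoC (INR (Factorial.fact n)) = poch 1 n.
Proof.
induction n as [|n IH]; [reflexivity|].
rewrite fact_simpl, mult_INR, RtoC_mult, IH, S_INR, RtoC_plus; simpl; ring.
Qed.

Lemma Cfalling_shift (w : C) (n : nat) : Cfalling w (S n) = w * Cfalling (w - 1) n.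
Proof.
induction n as [|n IH]; [simpl; ring|].
change (Cfalling w (S (S n))) with (Cfalling w (S n) * (w - INR (S n))).
rewrite IH, S_INR, RtoC_plus; simpl; ring.
Qed.

(** This is (2n)! / n!. In the induction the product is lengthened by its next factor, (2n+2) -
    (n+1) = n + 1; removing the two leading factors 2n + 2 and 2n + 1 then leaves the case n. *)
Lemma Cfalling_central (n : nat) : Cfalling (INR (2 * n)) n = 4 ^ n * poch (1 / 2) n.
Proof.
induction n as [|n IH]; [simpl; ring|].
pose proof (one_plus_neq_0 n) as M1.
assert (E : Cfalling (INR (2 * S n)) (S n) * (INR n + 1)
  = 4 ^ n * poch (1 / 2) n * (2 * (INR n + 1) * (2 * INR n + 1))).
{ transitivity (Cfalling (INR (2 * S n)) (S (S n))).
  - change (Cfalling (INR (2 * S n)) (S (S n)))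
      with (Cfalling (INR (2 * S n)) (S n) * (INR (2 * S n) - INR (S n))).
    rewrite !mult_INR, !RtoC_mult; change (INR 2) with 2%R.
    rewrite S_INR, RtoC_plus; ring.
  - rewrite !Cfalling_shift.
    replace (INR (2 * S n) - 1 - 1) with (RtoC (INR (2 * n))).
    + rewrite IH, mult_INR, RtoC_mult; change (INR 2) with 2%R.
      rewrite S_INR, RtoC_plus; ring.
    + rewrite !mult_INR, !RtoC_mult; change (INR 2) with 2%R.
      rewrite S_INR, RtoC_plus; ring. }
transitivity (Cfalling (INR (2 * S n)) (S n) * (INR n + 1) / (INR n + 1)); [field; neq_0|].
rewrite E; simpl poch; simpl Cpow; field; neq_0.
Qed.

(** The signs (-1)^n from the cube and from the lower binomial combine to (-1)^(2n) = 1; the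
    remaining minus is z - 2n = -(b + 2n). *)
Lemma summand_eq (z : C) (n : nat) :
  (forall k : Z, z <> 1 / 2 + IZR k) ->
  1 / 4 ^ n * Cbinom (INR (2 * n)) n
    * ((z - 2 * INR n) / Cbinom (z - 1 / 2) n) * Cbinom z n ^ 3
  = - term 0 (- z) n.
Proof.
intros Hz.
unfold term, poch_quotient, Cbinom.
rewrite Cfalling_central, !Cfalling_poch, !fact_poch.
replace (0 + - z) with (- z) by ring; replace (- (z - 1 / 2)) with (- z + 1 / 2) by ring.
rewrite Cplus_0_l.
assert (H4 : 4 ^ n <> 0) by (apply Cpow_nz, RtoC_neq_0; lra).
pose proof (poch_neq_0 1 n one_plus_neq_0) as N1.
assert (N2 : poch (- z + 1 / 2) n <> 0).
{ apply poch_neq_0; intros j E; apply (Hz (Z.of_nat j)); rewrite <- INR_IZR_INZ.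
  transitivity (1 / 2 + INR j - (- z + 1 / 2 + INR j)); [ring|rewrite E; ring]. }
assert (N3 : (-1) ^ n <> 0) by (apply Cpow_nz, RtoC_neq_0; lra).
assert (H2 : (-1) ^ n * (-1) ^ n = 1).
{ rewrite <- Cpow_mult_l; replace (-1 * -1) with (RtoC 1) by ring; apply Cpow_1_l. }
set (s := (-1) ^ n) in *.
transitivity (- ((- z + 2 * INR n) * (poch (- z) n * poch (- z) n ^ 2 * poch (1 / 2) n
  / (poch 1 n * poch 1 n ^ 2 * poch (- z + 1 / 2) n))) * (s * s)).
- field; auto.
- rewrite H2; ring.
Qed.

Lemma tan_series (z : C) :
  (Re z > - (1 / 2))%R ->
  (forall k : Z, z <> 1 / 2 + IZR k) ->
  is_Cseries
    (fun n : nat =>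
       1 / 4 ^ n * Cbinom (INR (2 * n)) n
       * ((z - 2 * INR n) / Cbinom (z - 1 / 2) n)
       * Cbinom z n ^ 3)
    (Ctan (PI * z) / PI).
Proof.
intros Hre Hz.
assert (Hb : (Re (- z) < 1 / 2)%R) by (destruct z; simpl in *; lra).
assert (Hhalf : forall k : Z, - z <> 1 / 2 + IZR k).
{ intros k E; apply (Hz (- k - 1)%Z); rewrite minus_IZR, opp_IZR, RtoC_minus, RtoC_opp.
  transitivity (- (- z)); [ring|rewrite E; field]. }
destruct (term_series_eval (- z) Hb Hhalf) as [S [HS E]].
pose proof (Ccos_PI_neq_0 (- z) Hhalf) as Hcos.
assert (HP : RtoC PI <> 0) by (apply RtoC_neq_0, PI_neq0).
replace (PI * - z) with (- (PI * z)) in * by ring.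
rewrite Csin_opp in E; rewrite Ccos_opp in E, Hcos.
replace (Ctan (PI * z) / PI) with (- S).
- apply (@is_series_ext C_AbsRing C_NormedModule (fun n => opp (term 0 (- z) n))).
  + intros n; symmetry; apply (summand_eq z n Hz).
  + now apply (@is_series_opp C_AbsRing C_NormedModule).
- unfold Ctan; replace (Csin (PI * z)) with (- (S * (PI * Ccos (PI * z)))) by (rewrite E; ring).
  field; auto.
Qed.

Lemma quarter_neq_half (m : nat) (k : Z) : INR m + 1 / 4 <> 1 / 2 + IZR k.
Proof.
(* Multiplied by 4, the equation equates the odd 4m + 1 with the even 2 + 4k. *)
intros E; apply (f_equal (fun w => Re (4 * w))) in E.
replace (4 * (INR m + 1 / 4)) with (RtoC (4 * INR m + 1)) in E
  by (rewrite RtoC_plus, RtoC_mult; field; apply RtoC_neq_0; lra).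
replace (4 * (1 / 2 + IZR k)) with (RtoC (2 + 4 * IZR k)) in E
  by (rewrite RtoC_plus, RtoC_mult; field).
rewrite !re_RtoC, INR_IZR_INZ, <- !mult_IZR, <- !plus_IZR in E.
apply eq_IZR in E; lia.
Qed.

Lemma Ctan_quarter (m : nat) : Ctan (PI * (INR m + 1 / 4)) = 1.
Proof.
pose proof (Ccos_PI_neq_0 _ (quarter_neq_half m)) as Hcos.
unfold Ctan; replace (Csin (PI * (INR m + 1 / 4))) with (Ccos (PI * (INR m + 1 / 4)));
  [field; exact Hcos|].
assert (E : PI * (INR m + 1 / 4) = RtoC (INR m * PI + PI / 4)).
{ rewrite RtoC_plus, RtoC_mult, RtoC_div by lra.
  field; apply RtoC_neq_0; lra. }
rewrite E; unfold RtoC; clear Hcos E.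
rewrite Ccos_eq, Csin_eq.
replace (cos (INR m * PI + PI / 4)) with (sin (INR m * PI + PI / 4)).
+ rewrite Ropp_0, Rminus_diag; apply injective_projections; simpl; unfold Rdiv; ring.
+ induction m as [|m IH]; [simpl; rewrite Rmult_0_l, Rplus_0_l, sin_cos_PI4; reflexivity|].
  rewrite S_INR; replace ((INR m + 1) * PI + PI / 4)%R with (INR m * PI + PI / 4 + PI)%R by ring.
  rewrite neg_sin, neg_cos, IH; reflexivity.
Qed.

Theorem corollary12 :
  (forall z : C,
     (Re z > - (1 / 2))%R ->
     (forall k : Z, z <> 1 / 2 + IZR k) ->
     @is_series C_AbsRing C_NormedModule
       (fun n : nat =>
          1 / 4 ^ n * Cbinom (INR (2 * n)) n
          * ((z - 2 * INR n) / Cbinom (z - 1 / 2) n)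
          * Cbinom z n ^ 3)
       (Ctan (PI * z) / PI))
  /\
  (forall m : nat,
     @is_series C_AbsRing C_NormedModule
       (fun n : nat =>
          1 / 4 ^ (n + 1) * Cbinom (INR (2 * n)) n
          * ((4 * INR m + 1 - 8 * INR n) / Cbinom (INR m - 1 / 4) n)
          * Cbinom (INR m + 1 / 4) n ^ 3)
       (1 / PI)).
Proof.
split; [exact tan_series|].
intros m.
assert (H4 : RtoC 4 <> 0) by (apply RtoC_neq_0; lra).
assert (Hre : (Re (INR m + 1 / 4) > - (1 / 2))%R).
{ pose proof (pos_INR m); replace (1 / 4) with (RtoC (1 / 4)) by (rewrite RtoC_div by lra; reflexivity).
  rewrite <- RtoC_plus, re_RtoC; lra. }
pose proof (tan_series _ Hre (quarter_neq_half m)) as T; rewrite Ctan_quarter in T.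
(* At z = m + 1/4 one has 4 (z - 2n) = 4m + 1 - 8n, which accounts for the exponent n + 1 of 4. *)
apply (@is_series_ext C_AbsRing C_NormedModule) with (2 := T).
intros n; match goal with |- ?x = ?y => change (x = y :> C) end.
assert (H4n : 4 ^ n <> 0) by now apply Cpow_nz.
replace (INR m + 1 / 4 - 1 / 2) with (INR m - 1 / 4) by (field; exact H4).
rewrite Cpow_add_r, Cpow_1_r; unfold Cdiv.
(* With the inverse as an atom, [field] does not ask for this binomial to be nonzero. *)
generalize (/ Cbinom (INR m - 1 * / 4) n); intros v.
field; auto.
Qed.
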